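(* Let $\mathbb{K}$ be an algebraically closed field of characteristic zero, let $k\geq 3$, let $n_0,n_1,\dots,n_k\ge 1$, and let $\lambda_2,\dots,\lambda_k\in\mathbb{K}\setminus\{0\}$ be pairwise distinct. (a) Type $V_5$: let $X$ be the trinomial variety that is the common zero set of the polynomials $$\lambda_iT_{01}^2\widehat T_0^{2m_0}+T_{11}^2\widehat T_1^{2m_1}+T_{i1}^2\widehat T_i^{2m_i},\qquad 2\le i\le k,$$ where all $m_{ij}$ are positive integers. Then $X$ is rigid and, consequently, not flexible. (b) Type $V_2$: let $X$ be the trinomial variety that is the common zero set of the polynomials $$\lambda_iT_{01}^2\cdots T_{0n_0}^2+T_{11}^2\cdots T_{1n_1}^2+T_{i1}^{l_{i1}}\cdots T_{in_i}^{l_{in_i}},\qquad 2\le i\le k,$$ where all $l_{ij}$ are positive integers. Assume that there exist at least two distinct indices $i_1,i_2\in\{2,\dots,k\}$ such that for $s=1,2$ there is no $j\in\{1,\dots,n_{i_s}\}$ with $l_{i_sj}=1$. Then $X$ is rigid and, consequently, not flexible.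
   Context: The $T_{ij}$ ($0\le i\le k$, $1\le j\le n_i$) are coordinates on the affine space of dimension $n_0+n_1+\dots+n_k$ over $\mathbb{K}$, and the varieties are considered in this affine space (there are no additional variables). Notation: $\widehat T_i^{2m_i}=T_{i2}^{2m_{i2}}T_{i3}^{2m_{i3}}\cdots T_{in_i}^{2m_{in_i}}$ (equal to $1$ if $n_i=1$). Trinomial varieties are known to be irreducible and normal. Let $\mathbb{G}_a$ be the additive group of $\mathbb{K}$. A $\mathbb{G}_a$-action on an affine variety $X$ is a regular action of the algebraic group $\mathbb{G}_a$ on $X$. The variety $X$ is called rigid if it admits no non-trivial $\mathbb{G}_a$-actions. An irreducible affine variety $X$ is called flexible if for every regular (smooth) point $x\in X$ the tangent space $T_xX$ is spanned by the tangent vectors at $x$ to the orbits of $x$ under various $\mathbb{G}_a$-actions on $X$. *)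

(* Defs.v *)
From HB Require Import structures.
From mathcomp Require Import all_boot all_order all_algebra.
From mathcomp Require Import mpoly.

Set Implicit Arguments.
Unset Strict Implicit.
Unset Printing Implicit Defensive.

Import GRing.Theory.
Local Open Scope ring_scope.

Section AffineVarieties.
Variables (K : closedFieldType) (N : nat).
Implicit Types (X : 'rV[K]_N -> Prop) (x v : 'rV[K]_N) (f : {mpoly K[N]}).

(* As K is algebraically closed, a closed subvariety of the affine space K^N
   is represented by its set X of K-points. *)

Definition evalp f x : K := f.@[x ord0].

Definition vanishing X f : Prop := forall x, X x -> evalp f x = 0.

(* A morphism from the affine line times X to K^N is the restriction of a
   tuple of polynomials in K[x_1, .., x_N][t]; in F i the time t is the
   variable of the outer {poly _}. *)
Definition orbit_poly (F : 'I_N -> {poly {mpoly K[N]}}) x (i : 'I_N) :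
    {poly K} :=
  map_poly (meval (x ord0)) (F i).

Definition flow (F : 'I_N -> {poly {mpoly K[N]}}) (t : K) x : 'rV[K]_N :=
  \row_i (orbit_poly F x i).[t].

Definition Ga_action X (F : 'I_N -> {poly {mpoly K[N]}}) : Prop :=
  [/\ forall t x, X x -> X (flow F t x),
      forall x, X x -> flow F 0 x = x
    & forall s t x, X x -> flow F (s + t) x = flow F s (flow F t x)].

Definition trivial_action X (F : 'I_N -> {poly {mpoly K[N]}}) : Prop :=
  forall t x, X x -> flow F t x = x.

Definition rigid X : Prop := forall F, Ga_action X F -> trivial_action X F.

Definition tangent X x v : Prop :=
  forall f, vanishing X f -> \sum_(j < N) evalp (mderiv j f) x * v ord0 j = 0.

(* Algebraic independence of the restrictions of g_1, .., g_d to X, i.e. of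
   their classes in the coordinate ring K[X]. *)
Definition alg_independent_on X (d : nat) (g : 'I_d -> {mpoly K[N]}) : Prop :=
  forall P : {mpoly K[d]},
    (forall x, X x -> P.@[fun i => evalp (g i) x] = 0) -> P = 0.

(* The dimension of X is the transcendence degree of K[X] over K. *)
Definition has_dim X (d : nat) : Prop :=
  (exists g : 'I_d -> {mpoly K[N]}, alg_independent_on X g) /\
  (forall (e : nat) (g : 'I_e -> {mpoly K[N]}),
     alg_independent_on X g -> (e <= d)%N).

(* For X irreducible: x is a regular point iff dim T_x X = dim X. *)
Definition regular_point X x : Prop :=
  X x /\ exists U : {vspace 'rV[K]_N},
    (forall v, v \in U <-> tangent X x v) /\ has_dim X (\dim U).

(* The velocity at t = 0 of t |-> t.x; in characteristic 0 its multiples are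
   the tangent vectors at x to the orbit of x. *)
Definition velocity (F : 'I_N -> {poly {mpoly K[N]}}) x : 'rV[K]_N :=
  \row_i ((orbit_poly F x i)^`()).[0].

Definition orbit_tangent X x v : Prop :=
  exists2 F, Ga_action X F & v = velocity F x.

(* Flexibility of an irreducible X. Irreducibility is not a conjunct, so that
   the negation really provides a regular point whose tangent space is not
   spanned by tangent vectors to orbits. *)
Definition flexible X : Prop :=
  forall x, regular_point X x ->
    forall v, tangent X x v <->
      exists2 s : seq 'rV[K]_N,
        (forall w, w \in s -> orbit_tangent X x w) & v \in <<s>>%VS.

End AffineVarieties.

(* The index set of the coordinates T_ij. Here i ranges over 0, .., k, and j,
   which mathematically ranges over 1, .., n_i, is shifted to 0, .., n_i - 1:
   T_i1 has j of value 0. *)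
Definition var_index (k : nat) (n : 'I_k.+1 -> nat) : finType :=
  {i : 'I_k.+1 & 'I_(n i)}.

Section Trinomials.
Variables (K : closedFieldType) (k : nat) (n : 'I_k.+1 -> nat).

Definition Tvar (i : 'I_k.+1) (j : 'I_(n i)) : {mpoly K[#|var_index n|]} :=
  'X_(enum_rank (Tagged (fun i => 'I_(n i)) j : var_index n)).

Definition Tmonomial (l : forall i : 'I_k.+1, 'I_(n i) -> nat) (i : 'I_k.+1) :
    {mpoly K[#|var_index n|]} :=
  \prod_(j < n i) Tvar j ^+ l i j.

(* inord 1 is the index 1 as soon as k >= 1. *)
Definition trinomial (lam : 'I_k.+1 -> K)
    (l : forall i : 'I_k.+1, 'I_(n i) -> nat) (i : 'I_k.+1) :
    {mpoly K[#|var_index n|]} :=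
  lam i *: Tmonomial l ord0 + Tmonomial l (inord 1) + Tmonomial l i.

Definition trinomial_variety (lam : 'I_k.+1 -> K)
    (l : forall i : 'I_k.+1, 'I_(n i) -> nat) (x : 'rV[K]_#|var_index n|) :
    Prop :=
  forall i : 'I_k.+1, (2 <= i)%N -> evalp (trinomial lam l i) x = 0.

End Trinomials.

(* Exponents of T_i1^2 T_i2^(2 m_i2) ... T_in_i^(2 m_in_i). *)
Definition exponents_V5 (k : nat) (n : 'I_k.+1 -> nat)
    (m : forall i : 'I_k.+1, 'I_(n i) -> nat) (i : 'I_k.+1) (j : 'I_(n i)) :
    nat :=
  if val j == 0%N then 2%N else (2 * m i j)%N.

Definition exponents_V2 (k : nat) (n : 'I_k.+1 -> nat)
    (l : forall i : 'I_k.+1, 'I_(n i) -> nat) (i : 'I_k.+1) (j : 'I_(n i)) :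
    nat :=
  if (i < 2)%N then 2%N else l i j.

Definition V5 (K : closedFieldType) (k : nat) (n : 'I_k.+1 -> nat)
    (lam : 'I_k.+1 -> K) (m : forall i : 'I_k.+1, 'I_(n i) -> nat) :
    'rV[K]_#|var_index n| -> Prop :=
  trinomial_variety lam (exponents_V5 m).

Definition V2 (K : closedFieldType) (k : nat) (n : 'I_k.+1 -> nat)
    (lam : 'I_k.+1 -> K) (l : forall i : 'I_k.+1, 'I_(n i) -> nat) :
    'rV[K]_#|var_index n| -> Prop :=
  trinomial_variety lam (exponents_V2 l).

(* Main.v *)
Require Import Defs.
From HB Require Import structures.
From mathcomp Require Import all_boot all_order all_algebra all_field.
From mathcomp Require Import mpoly.
From mathcomp Require Import ring zify.
From Stdlib Require Import FunctionalExtensionality.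

Set Implicit Arguments.
Unset Strict Implicit.
Unset Printing Implicit Defensive.

Import GRing.Theory.
Local Open Scope ring_scope.

(* Write B_i for the i-th monomial; B_0 = y_0^2 and B_1 = y_1^2 are squares.
   Let a G_a-action be given and let c be the orbit of a point of X with all
   coordinates nonzero.  Along c, with mu_i^2 = - lambda_i, the polynomials
   (y_1 + mu_i y_0)(y_1 - mu_i y_0) = - B_i in the time t have only multiple
   roots for the two distinguished indices i.  If y_0 and y_1 have no common
   root, this gives four members of a pencil of coprime polynomials without
   simple roots, and comparing their product with the squared Wronskian shows
   that y_0 and y_1 are constant; then every coordinate is constant along c.

   Otherwise c meets the locus where all B_i vanish.  This locus is a union of
   coordinate subspaces and has codimension 2 in X, so the orbits through it
   sweep out a set on which the free coordinates of X (all but one in each block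
   i >= 2) satisfy a nontrivial polynomial relation.  Hence the action is trivial
   wherever a certain nonzero polynomial in the free coordinates does not vanish.

   To extend this to all of X without appealing to irreducibility or to the
   Nullstellensatz: modulo the trinomials and after multiplication by a power of
   a fixed monomial M, every polynomial is reduced to one of small degree in the
   pivot coordinates; if it vanishes generically, it reduces to 0.  Through every
   point of X there are polynomial curves satisfying the trinomials to arbitrarily
   high order but with M vanishing only to a fixed order, so the generic
   vanishing propagates.  The same reduction gives the dimension and the tangent
   spaces of X, hence a regular point with a nonzero tangent vector. *)

(** * Polynomials in one variable *)

Section Univariate.
Variable K : closedFieldType.
Hypothesis charK0 : [pchar K] =i pred0.
Implicit Types (p q a b : {poly K}).

Lemma exists_root p : (1 < size p)%N -> exists r, root p r.
Proof.
move=> sp; apply/closed_rootP; apply/eqP => sp1; by rewrite sp1 in sp.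
Qed.

(** Induction on the size of [p]: cancelling a linear factor from [p] and [q] lowers both
    multiplicities at its root by one and changes none elsewhere. *)
Lemma dvdp_root_powers p q : p != 0 ->
  (forall r n, ('X - r%:P) ^+ n %| p -> ('X - r%:P) ^+ n %| q) -> p %| q.
Proof.
have [n sp] := ubnP (size p); elim: n p q sp => // n IH p q sp p0 h.
have [s1|s1] := leqP (size p) 1.
  by rewrite dvdUp // -size_poly_eq1 eqn_leq s1 size_poly_gt0.
have [r pr] := exists_root s1.
have /dvdpP [q1 eq1] : 'X - r%:P %| q.
  by have := h r 1%N; rewrite expr1; apply; rewrite dvdp_XsubCl.
move: pr; rewrite -dvdp_XsubCl => /dvdpP [p1 ep1].
have p10 : p1 != 0 by apply: contraNneq p0 => e; rewrite ep1 e mul0r.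
rewrite ep1 eq1 dvdp_mul2r ?polyXsubC_eq0 //.
apply: IH => //.
  move: sp; rewrite ep1 size_mul ?polyXsubC_eq0 // size_XsubC addn2 /=.
  by rewrite ltnS.
move=> z m hz; have [e|zr] := eqVneq z r.
  have /h : ('X - z%:P) ^+ m.+1 %| p.
    by rewrite ep1 exprSr e dvdp_mul2r ?polyXsubC_eq0 -?e.
  by rewrite eq1 exprSr e dvdp_mul2r ?polyXsubC_eq0.
have /h : ('X - z%:P) ^+ m %| p by rewrite ep1 dvdp_mulr.
rewrite eq1 Gauss_dvdpl //; apply: coprimep_expl.
rewrite coprimep_XsubC root_XsubC; by rewrite eq_sym.
Qed.

Definition squareful p := forall r, root p r -> ('X - r%:P) ^+ 2 %| p.

Lemma squareful_factor p q : (forall r, root p r -> ~~ root q r) ->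
  squareful (p * q) -> squareful p.
Proof.
move=> pq sq r pr; have : ('X - r%:P) ^+ 2 %| p * q by apply: sq; rewrite rootM pr.
by rewrite Gauss_dvdpl // coprimep_sym coprimep_expr // coprimep_XsubC pq.
Qed.

Lemma coprimep_no_common_root p q : ~ (exists r, root p r /\ root q r) -> coprimep p q.
Proof.
move=> npq; rewrite coprimep_def; apply: contra_notT npq => /closed_rootP [r].
by rewrite root_gcd => /andP [pr qr]; exists r.
Qed.

(** * Wronskians and pencils of polynomials *)

Definition wronskian a b := a * b^`() - a^`() * b.

Lemma XsubC_expS_dvd_deriv r n p :
  ('X - r%:P) ^+ n.+1 %| p -> ('X - r%:P) ^+ n %| p^`().
Proof.
move=> /dvdpP [q ->]; rewrite derivM deriv_exp derivXsubC mul1r.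
by rewrite dvdp_addr ?dvdp_mull // ?dvdpp // ?exprS ?dvdp_mull // -mulr_natl dvdp_mull.
Qed.

(** At a root of multiplicity n >= 2 of [p] the Wronskian is divisible by the power n - 1 of the
    linear factor, and 2 (n - 1) >= n. *)
Lemma squareful_dvd_wronskian p a : p != 0 -> squareful p -> p %| wronskian a p ^+ 2.
Proof.
move=> p0 sq; apply: dvdp_root_powers => // r [|[|n]] h; first by rewrite expr0 dvd1p.
  rewrite expr1 in h *.
  have rp : root p r by rewrite -dvdp_XsubCl.
  have /(@XsubC_expS_dvd_deriv r 1) h' := sq r rp; rewrite expr1 in h'.
  by rewrite expr2 dvdp_mull // /wronskian dvdp_sub // dvdp_mull.
have : ('X - r%:P) ^+ n.+1 %| wronskian a p.
  rewrite /wronskian dvdp_sub // dvdp_mull //; first exact: XsubC_expS_dvd_deriv.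
  by apply: dvdp_trans h; rewrite [_ ^+ n.+2]exprS dvdp_mull.
move=> /(dvdp_exp2r 2); apply: dvdp_trans; rewrite -exprM dvdp_exp2l //.
by rewrite muln2 -addnn addSn addnS !ltnS leq_addr.
Qed.

(** In degrees the bound reads deg W < deg a + deg b. *)
Lemma size_wronskian a b : wronskian a b != 0 ->
  (size (wronskian a b) + 2 <= size a + size b)%N.
Proof.
move=> W0.
have side (p q : {poly K}) : (size (p * q^`())%R <= size p + size q - 2)%N.
  have [-> | q0] := eqVneq q^`() 0; first by rewrite mulr0 size_poly0.
  have sq : (size q^`() < size q)%N by apply: lt_size_deriv; apply: contraNneq q0 => ->; rewrite deriv0.
  apply: leq_trans (size_polyMleq _ _) _.
  have sq0 : (0 < size q^`())%N by rewrite size_poly_gt0.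
  by case: (size q) sq => // m sq; rewrite addnS !subSS subn1 -!subn1 leq_sub2r // leq_add2l.
have sW : (size (wronskian a b) <= size a + size b - 2)%N.
  apply: leq_trans (size_polyD _ _) _; rewrite size_polyN geq_max side /=.
  by rewrite mulrC addnC side.
have W1 : (0 < size (wronskian a b))%N by rewrite size_poly_gt0.
have : (2 < size a + size b)%N by rewrite -subn_gt0; apply: leq_trans sW.
by move=> /ltnW h; rewrite -(subnK h) leq_add2r.
Qed.

Lemma deriv_eq0_size p : p^`() = 0 -> (size p <= 1)%N.
Proof.
move=> p'0; rewrite leqNgt; apply/negP => sp.
have : p^`()`_(size p).-2 = 0 by rewrite p'0 coef0.
rewrite coef_deriv => /eqP.
have -> : (size p).-2.+1 = (size p).-1 by case: (size p) sp => [|[|?]].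
rewrite -mulr_natr mulf_eq0 -[p`__]/(lead_coef p) lead_coef_eq0.
have -> : (p == 0) = false by apply/negbTE; apply: contraTneq sp => ->; rewrite size_poly0.
rewrite /= -[X in X%:R]prednK; last by case: (size p) sp => [|[|?]].
by move/pcharf0P: charK0 => ->; rewrite prednK //; case: (size p) sp => [|[|?]].
Qed.

(** Coprimality turns a b' = a' b into a | a', which by degree forces a' = 0; in characteristic zero
    a is then constant. *)
Lemma coprime_wronskian0 a b : coprimep a b -> wronskian a b = 0 ->
  (size a <= 1)%N /\ (size b <= 1)%N.
Proof.
move=> cab /eqP; rewrite subr_eq0 => /eqP E.
have main (p q : {poly K}) : coprimep p q -> p * q^`() = p^`() * q -> (size p <= 1)%N.
  move=> cpq e; apply: deriv_eq0_size; apply/eqP; apply: contraTT isT => p'0 /=.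
  have : p %| p^`() by rewrite -(Gauss_dvdpl _ cpq) -e dvdp_mulr.
  move=> /(dvdp_leq p'0); rewrite leqNgt lt_size_deriv //.
  by apply: contraNneq p'0 => ->; rewrite deriv0.
split; first exact: main cab E.
by apply: (main b a); rewrite 1?coprimep_sym // mulrC -E mulrC.
Qed.

Lemma wronskian_pencil a b (c d : K) :
  wronskian (b + c *: a) (b + d *: a) = (c - d) *: wronskian a b.
Proof.
by rewrite /wronskian !derivE -!mul_polyC rmorphB /=; ring.
Qed.

(** If W is nonzero, the four members are pairwise coprime divisors of W^2, so their degrees add up
    to at most 2 deg W; two disjoint pairs bound 2 deg W by that sum minus 2. *)
Lemma four_squareful_pencil a b (c : 'I_4 -> K) : injective c -> coprimep a b ->
  (forall j, b + c j *: a != 0) -> (forall j, squareful (b + c j *: a)) ->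
  (size a <= 1)%N /\ (size b <= 1)%N.
Proof.
move=> cI cab p0 sq; apply: coprime_wronskian0 => //; apply/eqP; apply: contraT => W0.
pose p j := b + c j *: a.
have pd j : p j %| wronskian a b ^+ 2.
  have W_eq : wronskian a (p j) = wronskian a b.
    by rewrite /wronskian /p !derivE -!mul_polyC; ring.
  by rewrite -W_eq; have := squareful_dvd_wronskian a (p0 j) (sq j).
have cop i j : i != j -> coprimep (p i) (p j).
  move=> ij; have cij : c i - c j != 0 by rewrite subr_eq0 (inj_eq cI).
  have e1 : p i - p j = (c i - c j) *: a by rewrite /p -!mul_polyC rmorphB /=; ring.
  have e2 : c i *: p j - c j *: p i = (c i - c j) *: b.
    by rewrite /p -!mul_polyC rmorphB /=; ring.
  apply/coprimepP => d d1 d2.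
  have da : d %| a by rewrite -(dvdpZr d _ cij) -e1 dvdp_sub.
  have db : d %| b by rewrite -(dvdpZr d _ cij) -e2 dvdp_sub // -mul_polyC dvdp_mull.
  by have /coprimepP/(_ d da db) := cab.
(* Any two members span the pencil, so their Wronskian is a nonzero multiple of W. *)
have Wij i j : i != j -> (size (wronskian a b) + 2 <= size (p i) + size (p j))%N.
  move=> ij; have cij : c i - c j != 0 by rewrite subr_eq0 (inj_eq cI).
  have := @size_wronskian (p i) (p j); rewrite wronskian_pencil size_scale //; apply.
  by rewrite scaler_eq0 negb_or cij.
pose o j (H : (j < 4)%N) : 'I_4 := Ordinal H.
pose i0 := o 0%N isT; pose i1 := o 1%N isT; pose i2 := o 2%N isT; pose i3 := o 3%N isT.
have dv : p i0 * p i1 * (p i2 * p i3) %| wronskian a b ^+ 2.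
  by rewrite !Gauss_dvdp ?pd ?coprimepMl ?coprimepMr ?cop.
have := dvdp_leq (expf_neq0 2 W0) dv.
have := Wij i0 i1 isT; have := Wij i2 i3 isT.
have p'0 j : p j != 0 := p0 j.
rewrite !size_mul ?mulf_neq0 ?p'0 //.
have sp j : (0 < size (p j))%N by rewrite size_poly_gt0 p0.
have := sp i0; have := sp i1; have := sp i2; have := sp i3.
have := W0; rewrite -size_poly_gt0.
move: (size (p i0)) (size (p i1)) (size (p i2)) (size (p i3)) (size (wronskian a b)).
lia.
Qed.

(** Hensel lifting of the root [y] of the constant term, one power of X at a time. *)
Lemma polyX_dvd_exp_root (n l : nat) (w : {poly K}) (y : K) : (0 < l)%N ->
  w.[0] != 0 -> y ^+ l = w.[0] ->
  exists2 r : {poly K}, r.[0] = y & 'X^n %| r ^+ l - w.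
Proof.
move=> l0 w0 yl.
have y0 : y != 0 by apply: contraNneq w0 => y0; rewrite -yl y0 expr0n eqn0Ngt l0.
have lK : l%:R != 0 :> K by move/pcharf0P: charK0 => ->; rewrite -lt0n.
elim: n => [|n [r r0 /dvdpP [h eh]]].
  by exists y%:P; rewrite ?hornerC // expr0 dvd1p.
(* Divisibility by X only needs r(0) = y; a correction by a constant would spoil r(0), so this case
   is separate. *)
case: n eh => [|n] eh.
  exists r => //; rewrite expr1 -[X in X %| _]subr0 dvdp_XsubCl.
  by rewrite /root !hornerE r0 yl subrr.
(* Since (r + c X^(n+1))^l - r^l = c X^(n+1) S with S(0) = l y^(l-1), this c cancels the constant
   term of [h]. *)
pose c := - h.[0] / (l%:R * y ^+ l.-1).
exists (r + c *: 'X^(n.+1)).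
  by rewrite !hornerE r0 expr0n mulr0 addr0.
pose S := \sum_(i < l) (r + c *: 'X^(n.+1)) ^+ (l.-1 - i) * r ^+ i.
have S0 : S.[0] = l%:R * y ^+ l.-1.
  rewrite horner_sum (eq_bigr (fun=> y ^+ l.-1)); last first.
    move=> i _; rewrite !hornerE r0 expr0n mulr0 addr0 -exprD subnK //.
    by rewrite -ltnS prednK.
  by rewrite sumr_const card_ord mulr_natl.
have -> : (r + c *: 'X^(n.+1)) ^+ l - w = 'X^(n.+1) * (c *: S + h).
  rewrite -(subrK (r ^+ l) ((_ + _) ^+ l)) -addrA eh subrXX.
  by rewrite -/S [r + _]addrC addrK -!mul_polyC; ring.
rewrite [X in X %| _]exprSr dvdp_mul2l ?expf_neq0 ?polyX_eq0 //.
rewrite -['X]subr0 dvdp_XsubCl /root !hornerE S0 /c divfK ?addNr //.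
by rewrite mulf_neq0 // expf_neq0.
Qed.

End Univariate.

(** * Polynomials in several variables *)

Section PartialEvaluation.
Variables (K : fieldType) (N : nat).
Implicit Types (f g : {mpoly K[N]}) (v w : 'I_N) (m : 'X_{1..N}).

Definition mnm_erase v m : 'X_{1..N} := [multinom if w == v then 0%N else m w | w < N].

(** The substitution of [a] for X_v, written monomial by monomial so that the exponents of the other
    variables remain visible. *)
Definition peval v (a : K) f : {mpoly K[N]} :=
  \sum_(m <- msupp f) (f@_m * a ^+ m v) *: 'X_[mnm_erase v m].

Lemma meval_peval v a f (y : 'I_N -> K) :
  (peval v a f).@[y] = f.@[fun w => if w == v then a else y w].
Proof.
rewrite [RHS]mevalE /peval rmorph_sum /=; apply: eq_bigr => m _.
rewrite mevalZ mevalX -mulrA; congr (_ * _).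
rewrite (bigD1 v) //= [RHS](bigD1 v) //= mnmE eqxx expr0 mul1r; congr (_ * _).
by apply: eq_bigr => w /negbTE wv; rewrite mnmE wv.
Qed.

Lemma msupp_peval v a f m : m \in msupp (peval v a f) ->
  m v = 0%N /\ exists2 m', m' \in msupp f & forall w, w != v -> m w = m' w.
Proof.
move=> /msupp_sum_le /flattenP [s /mapP [m' ] ].
rewrite mem_filter /= => m'f -> /msuppZ_le; rewrite msuppX inE => /eqP ->.
split; first by rewrite mnmE eqxx.
by exists m' => // w /negbTE wv; rewrite mnmE wv.
Qed.

(** Grouped by monomials in the other variables, [f] has coefficients of degree below |S| in X_v; a
    nonzero one cannot vanish on all of [S]. *)
Lemma peval_neq0 v (S : seq K) f : f != 0 -> uniq S ->
  (forall m, m \in msupp f -> (m v < size S)%N) ->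
  exists2 a, a \in S & peval v a f != 0.
Proof.
move=> f0 uS bf; have m1f := mlead_supp f0; set m1 := mlead f in m1f.
pose p : {poly K} := \sum_(m <- msupp f | mnm_erase v m == mnm_erase v m1) f@_m *: 'X^(m v).
have p0 : p != 0.
  apply/eqP => /(congr1 (fun q : {poly K} => q`_(m1 v))).
  rewrite coef0 coef_sum big_mkcond (bigD1_seq m1) ?msupp_uniq //= eqxx.
  rewrite big1 => [|m mm]; last case: eqP => // e.
    by rewrite addr0 coefZ coefXn eqxx mulr1; apply/eqP; rewrite -mcoeff_msupp.
  rewrite coefZ coefXn; case: eqP => [e2|]; last by rewrite mulr0.
  case/negP: mm; apply/eqP/mnmP => w; have [->//|wv] := eqVneq w v.
  by move/mnmP/(_ w): e; rewrite !mnmE (negbTE wv).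
have sp : (size p <= size S)%N.
  apply: (big_ind (fun q : {poly K} => size q <= size S)%N).
  - by rewrite size_poly0.
  - by move=> q r hq hr; apply: leq_trans (size_polyD _ _) _; rewrite geq_max hq.
  move=> m _; have [/eqP c0|c0] := boolP (f@_m == 0); first by rewrite c0 scale0r size_poly0.
  by rewrite size_scale // size_polyXn bf // mcoeff_msupp.
have /allPn [a aS pa] : ~~ all (root p) S.
  by apply/negP => aS; have := max_poly_roots p0 aS uS; rewrite ltnNge sp.
exists a => //; apply: contraNneq pa => /(congr1 (mcoeff (mnm_erase v m1))).
rewrite mcoeff0 /peval raddf_sum /= => h.
rewrite /root -[X in _ == X]h horner_sum big_mkcond /=; apply/eqP/eq_bigr => m _.
rewrite mcoeffZ mcoeffX; case: eqP => _; last by rewrite mulr0.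
by rewrite hornerZ hornerXn mulr1.
Qed.

(** Successive substitutions from a finite grid, as in the combinatorial Nullstellensatz. The grid
    depends on the variable, so it may consist of the roots allowed by the equations of the
    variety. *)
Lemma peval_seq_neq0 (s : seq 'I_N) (S : 'I_N -> seq K) f : uniq s -> f != 0 ->
  (forall v, v \in s -> uniq (S v)) ->
  (forall v m, v \in s -> m \in msupp f -> (m v < size (S v))%N) ->
  exists a g, [/\ g != 0, forall v, v \in s -> a v \in S v,
    forall y, g.@[y] = f.@[fun w => if w \in s then a w else y w],
    forall m v, m \in msupp g -> v \in s -> m v = 0%N
    & forall m, m \in msupp g ->
      exists2 m', m' \in msupp f & forall v, v \notin s -> m v = m' v].
Proof.
elim: s => [|v s IH] /=.
  move=> _ f0 _ _; exists (fun=> 0), f; split=> // m mf; by exists m.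
move=> /andP [vs us] f0 uS bS.
have [||a [g [g0 aS ge gs gf]]] := IH us f0.
- by move=> w ws; apply: uS; rewrite inE ws orbT.
- by move=> w m ws; apply: bS; rewrite inE ws orbT.
have [||b bS' h0] := @peval_neq0 v (S v) g g0.
- by apply: uS; rewrite inE eqxx.
- by move=> m /gf [m' m'f ->] //; apply: bS => //; rewrite inE eqxx.
exists (fun w => if w == v then b else a w), (peval v b g); split=> //.
- move=> w; rewrite inE; have [->//|wv /=] := eqVneq w v; exact: aS.
- move=> y; rewrite meval_peval ge; apply: meval_eq => w; rewrite inE.
  by have [->|wv] := eqVneq w v; rewrite ?(negbTE vs) //=.
- move=> m w /msupp_peval [mv [m' m'g mm']]; rewrite inE.
  have [->//|wv /=] := eqVneq w v => ws; by rewrite mm' // (gs m').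
- move=> m /msupp_peval [mv [m' m'g mm']]; have [m'' m''f h] := gf _ m'g.
  exists m'' => // w; rewrite inE negb_or => /andP [wv ws].
  by rewrite mm' // h.
Qed.

End PartialEvaluation.

(** * Sample points in characteristic zero *)

Section CharZero.
Variables (K : fieldType) (charK0 : [pchar K] =i pred0).

Lemma natr_char0_inj : injective (fun n : nat => n%:R : K).
Proof.
have natr_eq n : (n%:R == 0 :> K) = (n == 0)%N by move/pcharf0P: charK0 => ->.
move=> m n; wlog mn : m n / (m <= n)%N => [H|e].
  by case: (leqP m n) => [/H//|/ltnW /H h e]; rewrite h.
apply/eqP; rewrite eqn_leq mn /= -subn_eq0 -natr_eq natrB //.
by rewrite e subrr.
Qed.

Definition natrs (n : nat) : seq K := [seq i%:R | i <- iota 0 n].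

Lemma natrs_uniq n : uniq (natrs n).
Proof. by rewrite map_inj_uniq ?iota_uniq //; apply: natr_char0_inj. Qed.

Lemma size_natrs n : size (natrs n) = n.
Proof. by rewrite size_map size_iota. Qed.

Lemma exists_not_in (s : seq K) : exists x, x \notin s.
Proof.
have /allPn [x _ xs] : ~~ all (mem s) (natrs (size s).+1); last by exists x.
apply/negP => /allP sub; have := uniq_leq_size (natrs_uniq (size s).+1) sub.
by rewrite size_natrs ltnn.
Qed.

Lemma poly_eq0_everywhere (p : {poly K}) : (forall x, p.[x] = 0) -> p = 0.
Proof.
move=> h; apply/eqP; apply: contraT => p0.
have aS : all (root p) (natrs (size p)) by apply/allP => x _; apply/eqP.
by have := max_poly_roots p0 aS (natrs_uniq _); rewrite size_natrs ltnn.
Qed.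

Lemma mexp_bound N (f : {mpoly K[N]}) m v : m \in msupp f -> (m v < msize f)%N.
Proof.
move=> /msize_mdeg_lt; apply: leq_ltn_trans; rewrite mdegE (bigD1 v) //=.
exact: leq_addr.
Qed.

Lemma mpoly_neq0_point N (f : {mpoly K[N]}) : f != 0 -> exists x, f.@[x] != 0.
Proof.
move=> f0.
have [||v _|v m _|a [g [g0 _ ge gs _]]] := @peval_seq_neq0 _ _ (enum 'I_N) (fun=> natrs (msize f)) f.
- exact: enum_uniq.
- exact: f0.
- exact: natrs_uniq.
- by rewrite size_natrs; apply: mexp_bound.
have m0 m : m \in msupp g -> m = 0%MM.
  by move=> mg; apply/mnmP => v; rewrite mnm0E (gs m) // mem_enum.
have gC : g = (g@_0%MM)%:MP.
  apply/mpolyP => m; rewrite mcoeffC; case: eqP => [->|mn0]; first by rewrite mulr1.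
  by rewrite mulr0; apply: memN_msupp_eq0; apply/negP => /m0.
exists (fun w => if w \in enum 'I_N then a w else 0); rewrite -(ge (fun=> 0)) gC mevalC.
by apply: contraNneq g0 => e; rewrite gC e mpolyC0.
Qed.

End CharZero.

(** * Linear dependence by counting monomials *)

Section LinearDependence.
Variable K : fieldType.

Lemma lin_dep (A G : finType) (a : A -> G -> K) : (#|G| < #|A|)%N ->
  exists c : A -> K, (exists x, c x != 0) /\ forall y, \sum_x c x * a x y = 0.
Proof.
move=> GA; pose M := \matrix_(i < #|A|, j < #|G|) a (enum_val i) (enum_val j).
have /rowV0Pn [r rk r0] : kermx M != 0.
  by rewrite -mxrank_eq0 mxrank_ker subn_eq0 -ltnNge (leq_ltn_trans (rank_leq_col M)).
exists (fun x => r 0 (enum_rank x)); split.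
  have /rV0Pn [j rj] := r0.
  by exists (enum_val j); rewrite enum_valK.
move=> y; move/sub_kermxP/rowP/(_ (enum_rank y)): rk; rewrite !mxE => {2}<-.
rewrite (reindex_onto enum_val enum_rank) /=; last by move=> x _; rewrite enum_rankK.
apply: eq_big => [i|i _]; first by rewrite enum_valK eqxx.
by rewrite !mxE enum_valK !enum_rankK.
Qed.

(** The n^e polynomials [R n h] involve at most (C n)^|J| L^N monomials; as e > |J|, they outnumber
    these once n > C^|J| L^N. *)
Lemma mpoly_dep N (J : {set 'I_N}) (e L C : nat)
    (R : forall n, {ffun 'I_e -> 'I_n} -> {mpoly K[N]}) :
  (#|J| < e)%N -> (0 < C)%N -> (0 < L)%N ->
  (forall n (h : {ffun 'I_e -> 'I_n}) m v, m \in msupp (R n h) ->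
     (m v < if v \in J then C * n else L)%N) ->
  exists n (c : {ffun 'I_e -> 'I_n} -> K),
    (exists h, c h != 0) /\ \sum_h c h *: R n h = 0.
Proof.
move=> Je C0 L0 bR; pose n := (C ^ #|J| * L ^ N).+1; exists n.
pose G := ({ffun {v | v \in J} -> 'I_(C * n)} * {ffun 'I_N -> 'I_L})%type.
pose mn (g : G) : 'X_{1..N} := [multinom if insub v is Some w then g.1 w : nat else g.2 v | v < N].
have cardG : (#|{: G}| < #|{ffun 'I_e -> 'I_n}|)%N.
  rewrite card_prod !card_ffun !card_ord card_sig /=.
  have -> : #|[pred x in J]| = #|J| by apply: eq_card.
  rewrite expnMn mulnAC; apply: leq_trans (_ : n ^ #|J|.+1 <= _)%N; last by rewrite leq_pexp2l.
  by rewrite expnS ltn_pmul2r ?expn_gt0.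
have [c [c0 hc]] := lin_dep (fun h g => (R n h)@_(mn g)) cardG.
exists c; split=> //; apply/mpolyP => m; rewrite mcoeff0 raddf_sum /=.
under eq_bigr do rewrite mcoeffZ.
have [/existsP [h mh]|] := boolP [exists h, m \in msupp (R n h)]; last first.
  rewrite negb_exists => /forallP H; apply: big1 => h _.
  by rewrite (memN_msupp_eq0 (H h)) mulr0.
have Cn0 : (0 < C * n)%N by rewrite muln_gt0 C0.
pose g : G := ([ffun w => Ordinal (ltn_pmod (m (val w)) Cn0)],
               [ffun v => Ordinal (ltn_pmod (m v) L0)]).
suff -> : m = mn g by apply: hc.
apply/mnmP => v; rewrite mnmE; have := bR n h m v mh.
case: insubP => [w wJ wv|/negbTE ->] mv; rewrite ffunE /= modn_small ?wv //.
by rewrite wJ in mv.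
Qed.

End LinearDependence.

(** * Degree bounds in separate variables *)

Section ExponentBounds.
Variables (K : fieldType) (N : nat) (P : pred 'I_N).
Implicit Types (f g : {mpoly K[N]}) (E : 'I_N -> nat) (m : 'X_{1..N}).

(** The bound 0 means that no variable of [P] occurs in [f]. *)
Definition exp_le E f := forall m v, m \in msupp f -> P v -> (m v <= E v)%N.

Lemma exp_leW E E' f : (forall v, P v -> (E v <= E' v)%N) -> exp_le E f -> exp_le E' f.
Proof. by move=> EE h m v mf Pv; apply: leq_trans (h m v mf Pv) (EE v Pv). Qed.

Lemma exp_leD E f g : exp_le E f -> exp_le E g -> exp_le E (f + g).
Proof. by move=> hf hg m v /msuppD_le; rewrite mem_cat => /orP [/hf|/hg]; apply. Qed.

Lemma exp_leZ E c f : exp_le E f -> exp_le E (c *: f).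
Proof. by move=> hf m v /msuppZ_le /hf; apply. Qed.

Lemma exp_leN E f : exp_le E f -> exp_le E (- f).
Proof. by rewrite -scaleN1r; apply: exp_leZ. Qed.

Lemma exp_leX m : exp_le m 'X_[m].
Proof. by move=> m' v; rewrite msuppX inE => /eqP ->. Qed.

Lemma exp_leM E E' f g : exp_le E f -> exp_le E' g ->
  exp_le (fun v => E v + E' v)%N (f * g).
Proof.
move=> hf hg m v /msuppM_le /allpairsP [[m1 m2] /= [m1f m2g ->]] Pv.
by rewrite mnmDE leq_add ?hf ?hg.
Qed.

Lemma exp_leMW E E1 E2 f g : exp_le E1 f -> exp_le E2 g ->
  (forall v, P v -> (E1 v + E2 v <= E v)%N) -> exp_le E (f * g).
Proof. by move=> h1 h2 h; apply: exp_leW h (exp_leM h1 h2). Qed.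

Lemma exp_le1 E : exp_le E 1.
Proof. by move=> m v; rewrite -mpolyC1 msupp1 inE => /eqP ->; rewrite mnm0E. Qed.

Lemma exp_le_prod (I : finType) (Q : pred I) (E : I -> 'I_N -> nat) (f : I -> {mpoly K[N]}) :
  (forall i, Q i -> exp_le (E i) (f i)) ->
  exp_le (fun v => \sum_(i | Q i) E i v)%N (\prod_(i | Q i) f i).
Proof.
move=> h; rewrite -(big_filter _ Q).
apply: (@exp_leW (fun v => \sum_(i <- [seq i <- index_enum I | Q i]) E i v)%N).
  by move=> v _; rewrite big_filter.
have {}h : forall i, i \in [seq i <- index_enum I | Q i] -> exp_le (E i) (f i).
  by move=> i; rewrite mem_filter => /andP [/h].
elim: [seq _ <- _ | _] h => [|i s IH] h; first by rewrite big_nil; apply: exp_le1.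
rewrite big_cons; apply: exp_leMW (h i (mem_head _ _)) (IH _) _.
  by move=> j js; apply: h; rewrite inE js orbT.
by move=> v _; rewrite big_cons.
Qed.

Lemma exp_le_exp E f n : exp_le E f -> exp_le (fun v => n * E v)%N (f ^+ n).
Proof.
move=> h; elim: n => [|n IH]; first by rewrite expr0; apply: exp_le1.
by rewrite exprS; apply: exp_leMW h IH _ => v _; rewrite mulSn.
Qed.

Lemma exp_le_sum (I : Type) (s : seq I) (Q : pred I) E (f : I -> {mpoly K[N]}) :
  (forall i, Q i -> exp_le E (f i)) -> exp_le E (\sum_(i <- s | Q i) f i).
Proof.
move=> h; elim/big_ind: _ => //; last by move=> *; exact: exp_leD.
by move=> m v; rewrite -mpolyC0 msupp0.
Qed.

End ExponentBounds.

Lemma meval_exp_le0 (K : fieldType) N (P : pred 'I_N) (f : {mpoly K[N]}) x y :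
  exp_le P (fun=> 0%N) f -> (forall v, ~~ P v -> x v = y v) -> f.@[x] = f.@[y].
Proof.
move=> hf xy; rewrite !mevalE; apply: eq_big_seq => m mf; congr (_ * _).
apply: eq_bigr => v _; have [Pv|/xy -> //] := boolP (P v).
by have := hf m v mf Pv; rewrite leqn0 => /eqP ->; rewrite !expr0.
Qed.

(** Distinct [h] give distinct monomials, so a nontrivial linear relation among products of powers
    is a nontrivial algebraic relation. *)
Lemma exponent_poly (K : fieldType) (e n : nat) (c : {ffun 'I_e -> 'I_n} -> K) :
  (exists h, c h != 0) ->
  exists2 P : {mpoly K[e]}, P != 0 & forall y, P.@[y] = \sum_h c h * \prod_i y i ^+ h i.
Proof.
move=> [h0 c0]; pose mh (h : {ffun 'I_e -> 'I_n}) : 'X_{1..e} := [multinom (h i : nat) | i < e].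
have mh_inj : injective mh.
  move=> h h' /mnmP hh; apply/ffunP => i; apply: val_inj.
  by have := hh i; rewrite !mnmE.
exists (\sum_h c h *: 'X_[mh h]) => [|y]; last first.
  rewrite rmorph_sum; apply: eq_bigr => h _; rewrite /= mevalZ mevalX; congr (_ * _).
  by apply: eq_bigr => i _; rewrite mnmE.
apply: contraNneq c0 => /(congr1 (mcoeff (mh h0))).
rewrite mcoeff0 raddf_sum /= (bigD1 h0) //= mcoeffZ mcoeffX eqxx mulr1 => e0.
apply/eqP; rewrite -[RHS]e0 big1 ?addr0 // => h hh0.
by rewrite mcoeffZ mcoeffX (inj_eq mh_inj) (negbTE hh0) mulr0.
Qed.

Lemma power_product_exp_le (K : fieldType) (N e n : nat) (g : 'I_e -> {mpoly K[N]})
    (h : {ffun 'I_e -> 'I_n}) :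
  exp_le predT (fun=> n * \sum_i msize (g i))%N (\prod_i g i ^+ h i).
Proof.
have : exp_le predT (fun v => \sum_i h i * msize (g i))%N (\prod_i g i ^+ h i).
  apply: exp_le_prod => i _; have := @exp_le_exp _ _ predT (fun=> msize (g i)) (g i) (h i).
  by apply => m' v' m'g _; apply/ltnW/mexp_bound.
apply: exp_leW => v _; rewrite big_distrr /=; apply: leq_sum => i _.
by rewrite leq_mul2r (ltnW (ltn_ord _)) orbT.
Qed.

Lemma few_variables_alg_dep (K : fieldType) (N e : nat) (J : {set 'I_N}) (g : 'I_e -> {mpoly K[N]}) :
  (#|J| < e)%N -> (forall i, exp_le (fun v => v \notin J) (fun=> 0%N) (g i)) ->
  exists2 P : {mpoly K[e]}, P != 0 & forall x, P.@[fun i => (g i).@[x]] = 0.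
Proof.
move=> Je gJ; pose E := (\sum_i msize (g i))%N.
(* Here L = 1, as exponents outside [J] are 0. *)
have [||||n [c [c0 hc]]] := @mpoly_dep K N J e 1 E.+1 (fun n h => \prod_i g i ^+ h i) => //.
  move=> n h m v mg; case: ifPn => vJ.
    have n0 : (0 < n)%N by case: n h {mg} => // h; case: (h (Ordinal (leq_ltn_trans (leq0n _) Je))).
    by apply: leq_ltn_trans (power_product_exp_le mg isT) _; rewrite mulSn mulnC -addn1 addnC leq_add2r.
  have : exp_le (fun v => v \notin J) (fun v => \sum_(i < e) h i * 0)%N (\prod_i g i ^+ h i).
    by apply: exp_le_prod => i _; apply: exp_le_exp.
  by move=> /(_ m v mg vJ); rewrite big1 // => i _; rewrite muln0.
have [P P0 Pe] := exponent_poly c0; exists P => // x.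
rewrite Pe; transitivity (\sum_h c h *: \prod_i g i ^+ h i).@[x]; last by rewrite hc meval0.
rewrite rmorph_sum; apply: eq_bigr => h _; rewrite /= mevalZ rmorph_prod; congr (_ * _).
by apply: eq_bigr => i _; rewrite rmorphXn.
Qed.

(** * Extraction of roots in the field *)

Section Radicals.
Variables (K : closedFieldType) (charK0 : [pchar K] =i pred0).

Lemma exists_exp_root (l : nat) (c : K) : (0 < l)%N -> exists y, y ^+ l = c.
Proof.
move=> l0; have [|y] := @exists_root _ ('X^l - c%:P : {poly K}).
  by rewrite size_XnsubC.
by rewrite /root !hornerE subr_eq0 => /eqP <-; exists y.
Qed.

(** X^l - c is separable: its derivative l X^(l-1) vanishes at most at 0, which is not a root of X^l
    - c. *)
Lemma exp_roots (l : nat) (c : K) : (0 < l)%N -> c != 0 ->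
  exists s : seq K, [/\ uniq s, size s = l & forall z, z \in s -> z ^+ l = c].
Proof.
move=> l0 c0; have lK : l%:R != 0 :> K by move/pcharf0P: charK0 => ->; rewrite -lt0n.
have [s es] := closed_field_poly_normal ('X^l - c%:P : {poly K}).
have mon : 'X^l - c%:P \is monic by exact: monicXnsubC.
move: es; rewrite (monicP mon) scale1r => es; exists s; split.
- rewrite -separable_prod_XsubC -es separable_poly.unlock; apply/coprimepP => d d1 d2.
  rewrite -size_poly_eq1; apply: contraT => sd.
  have [r rd] : exists r, root d r by apply/closed_rootP.
  have : root ('X^l - c%:P) r by rewrite -dvdp_XsubCl; apply: dvdp_trans d1; rewrite dvdp_XsubCl.
  have : root ('X^l - c%:P)^`() r by rewrite -dvdp_XsubCl; apply: dvdp_trans d2; rewrite dvdp_XsubCl.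
  rewrite !derivE /root subr0 hornerMn hornerXn -mulr_natr mulf_eq0 (negbTE lK) orbF.
  move=> /eqP r0; rewrite /root !hornerE -(prednK l0) exprS r0 mulr0 sub0r oppr_eq0.
  by rewrite (negbTE c0).
- by have := size_prod_XsubC s id; rewrite -es size_XnsubC // => -[].
- move=> z zs; have : root ('X^l - c%:P) z by rewrite es root_prod_XsubC.
  by rewrite /root !hornerE subr_eq0 => /eqP.
Qed.

End Radicals.

(** * Trinomial varieties *)

Section TrinomialCore.
Variables (K : closedFieldType) (charK0 : [pchar K] =i pred0) (N k : nat).
(** The block of a coordinate, its exponent, a distinguished coordinate of each block (T_i1 in the
    application), and the coefficients. *)
Variables (b : 'I_N -> 'I_k.+1) (l : 'I_N -> nat) (u : 'I_k.+1 -> 'I_N) (lam : 'I_k.+1 -> K).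
Hypothesis k_ge2 : (2 <= k)%N.
Hypothesis l_gt0 : forall v, (0 < l v)%N.
Hypothesis bu : forall i, b (u i) = i.
Implicit Types (m : 'X_{1..N}) (f g : {mpoly K[N]}) (x y : 'I_N -> K) (i : 'I_k.+1) (v w : 'I_N).

Definition block_exp i : 'X_{1..N} := [multinom if b v == i then l v else 0%N | v < N].
Definition block i : {mpoly K[N]} := 'X_[block_exp i].
Definition coblock_exp i : 'X_{1..N} :=
  [multinom if (b v == i) && (v != u i) then l v else 0%N | v < N].
Definition coblock i : {mpoly K[N]} := 'X_[coblock_exp i].
Definition binom i : {mpoly K[N]} := lam i *: block ord0 + block (inord 1).
Definition trinom i : {mpoly K[N]} := binom i + block i.
Definition on_variety x := forall i, (2 <= i)%N -> (trinom i).@[x] = 0.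
(* The pivots are the coordinates eliminated by the trinomials; the remaining ones
   are algebraically independent on the variety. *)
Definition pivot v := (2 <= b v)%N && (v == u (b v)).
Definition pivot_free f := exp_le pivot (fun=> 0%N) f.
(** Normal forms: the trinomials eliminate the l_v-th power of a pivot v after multiplication by a
    coblock, so only lower powers remain. *)
Definition reduced f := exp_le pivot (fun v => (l v).-1) f.

Lemma pivot_u i : pivot (u i) = (2 <= i)%N.
Proof. by rewrite /pivot bu eqxx andbT. Qed.

Lemma val_inord1 : (inord 1 : 'I_k.+1) = 1%N :> nat.
Proof. by rewrite inordK // ltnS; apply: ltnW. Qed.

Lemma meval_block i x : (block i).@[x] = \prod_(v | b v == i) x v ^+ l v.
Proof.
rewrite mevalX [RHS]big_mkcond; apply: eq_bigr => v _.
by rewrite mnmE; case: ifP; rewrite ?expr0.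
Qed.

Lemma block_coblock i : block i = coblock i * 'X_(u i) ^+ l (u i).
Proof.
rewrite mpolyXn -mpolyXD; congr 'X_[_]; apply/mnmP => v.
rewrite mnmDE mulmnE mnm1E !mnmE; have [<-|vu] := eqVneq (u i) v.
  by rewrite bu eqxx mul1n.
by rewrite andbT mul0n addn0.
Qed.

Lemma block_pivot_free i : (i < 2)%N -> pivot_free (block i).
Proof.
move=> i2 m v; rewrite msuppX inE => /eqP -> /andP [bv _]; rewrite mnmE.
by case: eqP => // e; move: bv; rewrite e leqNgt i2.
Qed.

Lemma binom_pivot_free i : pivot_free (binom i).
Proof.
apply: exp_leD; last by apply: block_pivot_free; rewrite val_inord1.
by apply: exp_leZ; apply: block_pivot_free.
Qed.

Lemma coblock_pivot_free i : pivot_free (coblock i).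
Proof.
move=> m v; rewrite msuppX inE => /eqP -> /andP [_ /eqP e]; rewrite mnmE.
by case: eqP => //= bv; rewrite [in X in X == _]e bv eqxx.
Qed.

Lemma binom_neq0 i : binom i != 0.
Proof.
apply/eqP => /(congr1 (mcoeff (block_exp (inord 1)))).
rewrite mcoeff0 mcoeffD mcoeffZ !mcoeffX eqxx.
have -> : (block_exp ord0 == block_exp (inord 1)) = false.
  apply/eqP => /mnmP /(_ (u (inord 1))); rewrite !mnmE bu eqxx.
  have -> : (inord 1 == ord0 :> 'I_k.+1) = false.
    by apply/eqP => /(congr1 val); rewrite /= val_inord1.
  by move=> e; have := l_gt0 (u (inord 1)); rewrite -e.
by move/eqP; rewrite mulr0 add0r oner_eq0.
Qed.

Lemma reducedM_pivot_free f g : reduced f -> pivot_free g -> reduced (f * g).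
Proof. by move=> hf hg; apply: exp_leMW hf hg _ => v _; rewrite addn0. Qed.

Lemma pivot_freeM f g : pivot_free f -> pivot_free g -> pivot_free (f * g).
Proof. by move=> hf hg; apply: exp_leMW hf hg _. Qed.

Lemma pivot_free_prod (I : finType) (Q : pred I) (f : I -> {mpoly K[N]}) :
  (forall j, Q j -> pivot_free (f j)) -> pivot_free (\prod_(j | Q j) f j).
Proof. by move=> /exp_le_prod; apply: exp_leW => v _; rewrite big1. Qed.

(** Generic values of the free coordinates leave l_v distinct nonzero choices for each pivot v, and
    a nonzero polynomial of degree below l_v in each pivot cannot vanish at all these choices. *)
Lemma generic_point f : f != 0 -> reduced f ->
  exists x, [/\ on_variety x, forall v, x v != 0 & f.@[x] != 0].
Proof.
move=> f0 rf.
(* The second factor encodes the open conditions on the free coordinates; being pivot-free, it keeps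
   [g] reduced. *)
pose g := f * (\prod_(v | ~~ pivot v) 'X_v * \prod_i binom i).
have fg : pivot_free (\prod_(v | ~~ pivot v) 'X_v * \prod_i binom i).
  apply: pivot_freeM; first (apply: pivot_free_prod => v pv); last first.
    apply: pivot_free_prod => i _; exact: binom_pivot_free.
  move=> m w; rewrite msuppX inE => /eqP -> pw; rewrite mnm1E.
  by case: eqP => // e; rewrite e pw in pv.
have rg : reduced g by apply: reducedM_pivot_free.
have g0 : g != 0.
  rewrite !mulf_neq0 //; apply/prodf_neq0 => i _; last exact: binom_neq0.
  by rewrite -msize_poly_eq0 msizeX.
have [||v _|v m _|a [g1 [g10 _ ge gs gf]]] :=
   @peval_seq_neq0 _ _ (enum [pred v | ~~ pivot v]) (fun=> natrs K (msize g)) g.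
- exact: enum_uniq.
- exact: g0.
- exact: natrs_uniq.
- by rewrite size_natrs; apply: mexp_bound.
(* The values of [y] at the pivots are provisional and serve only to read off the open conditions on
   the free coordinates. *)
have [y g1y] := mpoly_neq0_point charK0 g10.
pose z := fun w => if w \in enum [pred v | ~~ pivot v] then a w else y w.
have zE v : ~~ pivot v -> z v = a v by rewrite /z mem_enum inE => ->.
move: (g1y); rewrite ge -/z /g !mevalM !mulf_eq0 !negb_or => /and3P [fz Xz Qz].
have a0 v : ~~ pivot v -> a v != 0.
  move=> pv; rewrite -zE //; move: Xz; rewrite rmorph_prod => /prodf_neq0 /(_ v pv).
  by rewrite /= mevalXU.
have Qz0 i : (binom i).@[z] != 0.
  by move: Qz; rewrite rmorph_prod => /prodf_neq0 /(_ i isT).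
have Mz0 i : (coblock i).@[z] != 0.
  rewrite mevalX; apply/prodf_neq0 => v _; rewrite mnmE; case: ifP => [|_]; last first.
    by rewrite expr0 oner_eq0.
  move=> /andP [/eqP bv vu]; rewrite expf_neq0 // zE ?a0 //;
  by rewrite /pivot bv negb_and vu orbT.
(* For a pivot v these are the l_v solutions in x_v of the trinomial equation of its block, the free
   coordinates being fixed. *)
have /fin_all_exists [S hS] : forall v, exists s : seq K, [/\ uniq s, size s = l v &
   forall t, t \in s -> t ^+ l v = - (binom (b v)).@[z] / (coblock (b v)).@[z] ].
  move=> v; apply: exp_roots => //.
  by rewrite mulf_neq0 ?invr_eq0 // oppr_eq0.
have [||v _|v m|a2 [g2 [g20 a2S ge2 gs2 gf2]]] :=
   @peval_seq_neq0 _ _ (enum pivot) S g1.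
- exact: enum_uniq.
- exact: g10.
- by have [] := hS v.
- rewrite mem_enum => pv /gf [m' m'g ->]; last by rewrite mem_enum inE negbK.
  have [_ -> _] := hS v; have := rg m' v m'g pv; have := l_gt0 v.
  by case: (l v).
have [y2 g2y] := mpoly_neq0_point charK0 g20.
move: g2y; rewrite ge2 ge; set x := (X in g.@[X]) => gx.
exists x.
have xa v : ~~ pivot v -> x v = a v by move=> pv; rewrite /x mem_enum inE pv.
have xp v : pivot v -> x v \in S v.
  move=> pv; rewrite /x mem_enum inE pv /= mem_enum /= ifT; last exact: pv.
  by apply: a2S; rewrite mem_enum.
have xz (h : {mpoly K[N]}) : pivot_free h -> h.@[x] = h.@[z].
  by move=> fh; apply: meval_exp_le0 fh _ => v pv; rewrite xa ?zE.
have xroot v : pivot v -> x v ^+ l v = - (binom (b v)).@[z] / (coblock (b v)).@[z].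
  by move=> /xp; have [_ _] := hS v; apply.
split.
- move=> i i2; rewrite /trinom block_coblock mevalD mevalM rmorphXn /= mevalXU.
  rewrite xroot ?pivot_u // bu !xz; [|exact: coblock_pivot_free|exact: binom_pivot_free].
  by rewrite mulrCA divff // mulr1 subrr.
- move=> v; have [pv|pv] := boolP (pivot v); last by rewrite xa ?a0.
  apply: contraNneq (Qz0 (b v)) => xv0; move: (xroot v pv).
  rewrite xv0 expr0n eqn0Ngt l_gt0 /= => /esym/eqP; rewrite mulf_eq0 invr_eq0.
  by rewrite (negbTE (Mz0 _)) orbF oppr_eq0.
- by move: gx; rewrite mevalM mulf_eq0 negb_or => /andP [].
Qed.

(** * Reduction modulo the trinomials *)

Definition in_ideal f := exists G : 'I_k.+1 -> {mpoly K[N]},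
  f = \sum_(i < k.+1 | (2 <= i)%N) G i * trinom i.

Lemma in_ideal0 : in_ideal 0.
Proof. by exists (fun=> 0); rewrite big1 // => i _; rewrite mul0r. Qed.

Lemma in_idealD f g : in_ideal f -> in_ideal g -> in_ideal (f + g).
Proof.
move=> [F ->] [G ->]; exists (fun i => F i + G i); rewrite -big_split.
by apply: eq_bigr => i _; rewrite mulrDl.
Qed.

Lemma in_idealM f g : in_ideal g -> in_ideal (f * g).
Proof.
move=> [G ->]; exists (fun i => f * G i); rewrite mulr_sumr.
by apply: eq_bigr => i _; rewrite mulrA.
Qed.

Lemma in_ideal_trinom i : (2 <= i)%N -> in_ideal (trinom i).
Proof.
move=> i2; exists (fun j => (j == i)%:R); rewrite (bigD1 i) //= eqxx mul1r.
by rewrite big1 ?addr0 // => j /andP [_ /negbTE ->]; rewrite mul0r.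
Qed.

Definition eq_mod f g := in_ideal (f - g).

Lemma eq_mod_refl f : eq_mod f f.
Proof. by rewrite /eq_mod subrr; apply: in_ideal0. Qed.

Lemma eq_modD f f' g g' : eq_mod f f' -> eq_mod g g' -> eq_mod (f + g) (f' + g').
Proof. by move=> h h'; rewrite /eq_mod opprD addrACA; apply: in_idealD. Qed.

Lemma eq_modM f f' g g' : eq_mod f f' -> eq_mod g g' -> eq_mod (f * g) (f' * g').
Proof.
move=> h h'; rewrite /eq_mod.
have -> : f * g - f' * g' = g * (f - f') + f' * (g - g') by ring.
by apply: in_idealD; apply: in_idealM.
Qed.

Lemma eq_mod_exp f g n : eq_mod f g -> eq_mod (f ^+ n) (g ^+ n).
Proof.
move=> h; elim: n => [|n IH]; first exact: eq_mod_refl.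
by rewrite !exprS; apply: eq_modM.
Qed.

Lemma eq_mod_prod (I : Type) (s : seq I) (Q : pred I) (f g : I -> {mpoly K[N]}) :
  (forall j, Q j -> eq_mod (f j) (g j)) ->
  eq_mod (\prod_(i <- s | Q i) f i) (\prod_(i <- s | Q i) g i).
Proof.
move=> h; elim/big_ind2: _ => //; first exact: eq_mod_refl.
by move=> *; apply: eq_modM.
Qed.

Lemma eq_mod_sum (I : Type) (s : seq I) (Q : pred I) (f g : I -> {mpoly K[N]}) :
  (forall j, Q j -> eq_mod (f j) (g j)) ->
  eq_mod (\sum_(i <- s | Q i) f i) (\sum_(i <- s | Q i) g i).
Proof.
move=> h; elim/big_ind2: _ => //; first exact: eq_mod_refl.
by move=> *; apply: eq_modD.
Qed.

Lemma in_ideal_meval f x : in_ideal f -> on_variety x -> f.@[x] = 0.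
Proof.
move=> [G ->] Xx; rewrite rmorph_sum big1 // => i i2.
by rewrite /= mevalM Xx // mulr0.
Qed.

(** The monomial whose powers clear the denominators in this elimination. *)
Definition den : {mpoly K[N]} := \prod_(i < k.+1 | (2 <= i)%N) coblock i.

Definition mnm_rem m : 'X_{1..N} :=
  [multinom if pivot v then m v %% l v else m v | v < N]%N.

Definition pivot_quo m i := (m (u i) %/ l (u i))%N.

(* Obtained from den^s X^m by coblock_i u_i^(l_i) = block_i = - binom_i. *)
Definition reduct (s : nat) m : {mpoly K[N]} := 'X_[mnm_rem m] *
  \prod_(i < k.+1 | (2 <= i)%N)
    (coblock i ^+ (s - pivot_quo m i) * (- binom i) ^+ pivot_quo m i).

Lemma mpolyX_rem m : 'X_[m] = 'X_[mnm_rem m] *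
  \prod_(i < k.+1 | (2 <= i)%N) ('X_(u i) ^+ l (u i)) ^+ pivot_quo m i :> {mpoly K[N]}.
Proof.
under eq_bigr do rewrite -exprM mpolyXn.
rewrite mprodXE -mpolyXD; congr 'X_[_]; apply/mnmP => v.
rewrite mnmDE mnm_sumE mnmE; case: ifP => pv; last first.
  rewrite big1 ?addn0 // => i i2; rewrite mulmnE mnm1E; case: eqP => // e.
  by rewrite -e pivot_u i2 in pv.
move: (pv) => /andP [b2 /eqP ev]; rewrite (bigD1 (b v)) //= big1 => [|i /andP [_ ib]].
  by rewrite addn0 mulmnE mnm1E -ev eqxx mul1n /pivot_quo -ev mulnC addnC -divn_eq.
rewrite mulmnE mnm1E; case: eqP => // e.
by rewrite -e bu eqxx in ib.
Qed.

Lemma reduct_eq_mod s m : (forall v, (m v <= s)%N) ->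
  eq_mod (den ^+ s * 'X_[m]) (reduct s m).
Proof.
move=> ms; rewrite mpolyX_rem mulrCA; apply: eq_modM; first exact: eq_mod_refl.
rewrite /den -prodrXl -big_split /=; apply: eq_mod_prod => i i2.
have qs : (pivot_quo m i <= s)%N by apply: leq_trans (ms (u i)); apply: leq_div.
rewrite -{1}(subnK qs) exprD -mulrA -exprMn -block_coblock.
apply: eq_modM; first exact: eq_mod_refl.
apply: eq_mod_exp; rewrite /eq_mod opprK addrC; exact: in_ideal_trinom.
Qed.

Lemma block_exp_le i : exp_le predT l (block i).
Proof. by move=> m v; rewrite msuppX inE => /eqP -> _; rewrite mnmE; case: ifP. Qed.

Lemma binom_exp_le i : exp_le predT l (binom i).
Proof. by apply: exp_leD; first apply: exp_leZ; apply: block_exp_le. Qed.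

Lemma coblock_exp_le i : exp_le predT l (coblock i).
Proof. by move=> m v; rewrite msuppX inE => /eqP -> _; rewrite mnmE; case: ifP. Qed.

Lemma reduct_reduced s m : reduced (reduct s m).
Proof.
apply: reducedM_pivot_free; last first.
  apply: pivot_free_prod => i _; apply: pivot_freeM.
    have := exp_le_exp (n := (s - pivot_quo m i)%N) (@coblock_pivot_free i).
    by apply: exp_leW => v; rewrite muln0.
  have := exp_le_exp (n := pivot_quo m i) (exp_leN (@binom_pivot_free i)).
  by apply: exp_leW => v; rewrite muln0.
move=> m' v; rewrite msuppX inE => /eqP -> pv; rewrite mnmE pv.
by rewrite -ltnS prednK // ltn_pmod.
Qed.

(** Growth linear in [s] is what the dimension count needs. *)
Lemma reduct_exp_le s m : (forall v, (m v <= s)%N) ->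
  exp_le predT (fun v => s + k.+1 * (s * l v))%N (reduct s m).
Proof.
move=> ms; apply: exp_leMW (@exp_leX _ _ predT (mnm_rem m)) _ _.
  apply: (exp_le_prod (E := fun _ v => s * l v)%N) => i _.
  apply: exp_leMW (exp_le_exp (@coblock_exp_le i)) (exp_le_exp (exp_leN (@binom_exp_le i))) _.
  move=> v _; rewrite -mulnDl subnK //; apply: leq_trans (ms (u i)); exact: leq_div.
move=> v _; rewrite /= sum_nat_const leq_add //; last first.
  by rewrite leq_mul2r; apply/orP; right; rewrite -[X in (_ <= X)%N]card_ord max_card.
rewrite mnmE; case: ifP => // _; apply: leq_trans (ms v); exact: leq_mod.
Qed.

Definition reduce s f := \sum_(m <- msupp f) f@_m *: reduct s m.

Lemma reduce_eq_mod f s : (forall m v, m \in msupp f -> (m v <= s)%N) ->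
  eq_mod (den ^+ s * f) (reduce s f).
Proof.
move=> fs; rewrite {1}(mpolyE f) mulr_sumr /reduce !big_seq; apply: eq_mod_sum => m mf.
rewrite -scalerAr -!mul_mpolyC; apply: eq_modM; first exact: eq_mod_refl.
by apply: reduct_eq_mod => v; apply: fs.
Qed.

Lemma reduce_reduced f s : reduced (reduce s f).
Proof. by apply: exp_le_sum => m _; apply: exp_leZ; apply: reduct_reduced. Qed.

Lemma reduce_exp_le f s : (forall m v, m \in msupp f -> (m v <= s)%N) ->
  exp_le predT (fun v => s + k.+1 * (s * l v))%N (reduce s f).
Proof.
move=> fs; rewrite /reduce big_seq; apply: exp_le_sum => m mf.
by apply: exp_leZ; apply: reduct_exp_le => v; apply: fs.
Qed.

(** A nonzero normal form R of den^s f would make R h nonzero and reduced, hence nonzero at a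
    generic point of the variety, where f = 0 forces R = 0. *)
Lemma generic_vanishing_in_ideal f h : h != 0 -> pivot_free h ->
  (forall x, on_variety x -> (forall v, x v != 0) -> h.@[x] != 0 -> f.@[x] = 0) ->
  exists s, in_ideal (den ^+ s * f).
Proof.
move=> h0 fh fX; exists (msize f).
have eR : eq_mod (den ^+ msize f * f) (reduce (msize f) f).
  by apply: reduce_eq_mod => m v mf; apply/ltnW/mexp_bound.
have rR := @reduce_reduced f (msize f); set R := reduce _ f in eR rR.
suff R0 : R = 0 by move: eR; rewrite /eq_mod R0 subr0.
apply/eqP; apply: contraT => R0.
have [||x [Xx x0]] := @generic_point (R * h); first by rewrite mulf_neq0.
  exact: reducedM_pivot_free.
rewrite mevalM mulf_eq0 negb_or => /andP [+ hx].
rewrite -[R](subKr (den ^+ msize f * f)) mevalB mevalM fX // mulr0.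
by rewrite (in_ideal_meval eR) // subrr eqxx.
Qed.

(** * Approximating curves and propagation of vanishing *)

Definition along (c : 'I_N -> {poly K}) f : {poly K} := mmap polyC c f.

Lemma horner_along c f t : (along c f).[t] = f.@[fun v => (c v).[t]].
Proof.
rewrite /along mevalE horner_sum; apply: eq_bigr => m _.
rewrite hornerM hornerC horner_prod; congr (_ * _).
by apply: eq_bigr => v _; rewrite horner_exp.
Qed.

Lemma along_block c i : along c (block i) = \prod_(v | b v == i) c v ^+ l v.
Proof.
rewrite /along mmapX [RHS]big_mkcond; apply: eq_bigr => v _.
by rewrite mnmE; case: ifP; rewrite ?expr0.
Qed.

Lemma along_monomial (a : 'I_N -> nat) (c : 'I_N -> {poly K}) m :
  along (fun v => 'X^(a v) * c v) 'X_[m] =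
  'X^(\sum_v a v * m v) * \prod_v c v ^+ m v.
Proof.
rewrite /along mmapX /mmap1 (eq_bigr (fun v => 'X^(a v * m v) * c v ^+ m v)).
  by rewrite big_split /= prodrXr.
by move=> v _; rewrite exprMn exprM.
Qed.

Lemma den_monomial : den = 'X_[(\sum_(i < k.+1 | (2 <= i)%N) coblock_exp i)%MM].
Proof. by rewrite /den mprodXE. Qed.

Lemma plane_vector : exists w : 'I_k.+1 -> K, (forall i, w i != 0) /\
  forall i, (2 <= i)%N -> lam i * w ord0 + w (inord 1) + w i = 0.
Proof.
(* With w_0 = 1 and w_1 = t the equations give w_i = - (lam_i + t); [t] avoids 0 and all - lam_i. *)
have [t ht] := exists_not_in charK0 (0 :: [seq - lam i | i <- enum 'I_k.+1]).
exists (fun i => if i == ord0 then 1 else if i == inord 1 then t else - (lam i + t)).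
have n10 : (inord 1 == ord0 :> 'I_k.+1) = false.
  by apply/eqP => /(congr1 val); rewrite /= val_inord1.
split=> [i|i i2].
  case: ifP => _; first exact: oner_neq0.
  move: ht; rewrite inE negb_or => /andP [t0 ht]; case: ifP => // _.
  rewrite oppr_eq0 addrC addr_eq0; apply: contra ht => /eqP ->.
  by apply/mapP; exists i => //; rewrite mem_enum.
rewrite eqxx n10 eqxx.
have -> : (i == ord0) = false by apply/eqP => e; rewrite e in i2.
have -> : (i == inord 1) = false by apply/eqP => e; rewrite e val_inord1 in i2.
by rewrite mulr1 subrr.
Qed.

(** The orders [a] are fixed before [n]: coordinates vanish to bounded order while the precision is
    arbitrary. *)
Lemma approx_curve x : on_variety x -> exists a : 'I_N -> nat, forall n,
  exists c : 'I_N -> {poly K}, [/\ forall v, (c v).[0] != 0,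
    forall v, ('X^(a v) * c v).[0] = x v
  & forall i, (2 <= i)%N -> 'X^n %| along (fun v => 'X^(a v) * c v) (trinom i)].
Proof.
move=> Xx; have [w [w0 wL]] := plane_vector.
(* The curve lifts the path W = B(x) + s^D w in the linear space of the values of
   (B_0, .., B_k): the zero coordinates of x in block i get order a_v in s, with
   sum_v a_v l_v = D, and one coordinate of the block absorbs an l-th root mod s^n. *)
pose P := (\prod_v l v)%N.
pose Z i := #|[pred v | (b v == i) && (x v == 0)]|.
pose D := (P * N`!)%N.
(* Each of the Z zero coordinates of a block contributes a_v l_v = P (N! / Z), which adds up to D;
   the division is exact as 0 < Z <= N. *)
pose a v := if x v == 0 then ((P %/ l v) * (N`! %/ Z (b v)))%N else 0%N.
exists a => n.
have P0 : (0 < P)%N by rewrite prodn_gt0.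
have D0 : (0 < D)%N by rewrite muln_gt0 P0 fact_gt0.
have lP v : (l v %| P)%N by rewrite /P (bigD1 v) //= dvdn_mulr.
have ZN i : (Z i <= N)%N by rewrite -[X in (_ <= X)%N]card_ord max_card.
have Zx v : x v = 0 -> (0 < Z (b v))%N.
  by move=> xv; apply/card_gt0P; exists v; rewrite inE xv !eqxx.
have Zdvd i : (0 < Z i)%N -> (Z i %| N`!)%N by move=> Zi; rewrite dvdn_fact // Zi ZN.
have a_gt0 v : x v = 0 -> (0 < a v)%N.
  move=> xv; rewrite /a xv eqxx muln_gt0 !divn_gt0 ?Zx //.
  by apply/andP; split; apply: dvdn_leq; rewrite ?fact_gt0 ?Zdvd ?Zx.
have asum i : (\sum_(v | b v == i) a v * l v = if Z i == 0 then 0 else D)%N.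
  rewrite (bigID (fun v => x v == 0)) /= [X in (_ + X)%N]big1 => [|v /andP [_ /negbTE xv]]; last first.
    by rewrite /a xv.
  rewrite addn0 (eq_bigr (fun=> P * (N`! %/ Z i)))%N => [|v /andP [/eqP bv xv]]; last first.
    by rewrite /a xv bv mulnAC divnK.
  rewrite sum_nat_const (_ : #|_| = Z i); last by apply: eq_card.
  case: eqP => [->//|/eqP]; rewrite -lt0n => Zi.
  by rewrite mulnCA [(Z i * _)%N]mulnC divnK ?Zdvd.
have Bx i : ((block i).@[x] == 0) = (Z i != 0)%N.
  rewrite meval_block; apply/prodf_eq0/idP => [[v bv]|].
    rewrite expf_eq0 => /andP [_ xv]; rewrite -lt0n; apply/card_gt0P; exists v.
    by rewrite inE bv.
  rewrite -lt0n => /card_gt0P [v]; rewrite inE => /andP [bv xv]; exists v => //.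
  by rewrite expf_eq0 l_gt0.
pose W i : {poly K} := (block i).@[x]%:P + w i *: 'X^D.
(* W_i with its power of X removed; its constant term is nonzero. *)
pose om i : {poly K} := if Z i == 0%N then W i else (w i)%:P.
have W_om i : W i = 'X^(if Z i == 0%N then 0 else D) * om i.
  rewrite /om; case: ifP => Zi; first by rewrite expr0 mul1r.
  have /eqP Bi : (block i).@[x] == 0 by rewrite Bx Zi.
  by rewrite /W Bi add0r -mul_polyC mulrC.
pose g0 v := if x v == 0 then 1 else x v.
have g00 v : g0 v != 0 by rewrite /g0; case: ifP => [_|/negbT //]; exact: oner_neq0.
pose C i := \prod_(v | b v == i) g0 v ^+ l v.
have C0 i : C i != 0 by apply/prodf_neq0 => v _; rewrite expf_neq0.
(* [pr i] pairs the coordinate absorbing the root with that root. In a block without zeros the root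
   must be 1 at 0 for the curve to start at [x]; otherwise a zero coordinate is used and any root
   will do. *)
have /fin_all_exists [pr hpr] : forall i, exists pr : 'I_N * {poly K},
   [/\ b pr.1 = i, pr.2.[0] != 0, x pr.1 != 0 -> pr.2.[0] = 1
     & 'X^n %| pr.2 ^+ l pr.1 - (C i)^-1 *: om i].
  move=> i; have [Zi|Zi] := boolP (Z i == 0%N).
    have om0 : ((C i)^-1 *: om i).[0] = 1.
      rewrite /om Zi /W !hornerE expr0n eqn0Ngt D0 mulr0 addr0.
      suff -> : (block i).@[x] = C i by rewrite mulVf.
      rewrite meval_block; apply: eq_bigr => v /eqP bv; rewrite /g0.
      by case: eqP => // /Zx; rewrite bv lt0n Zi.
    have om1 : ((C i)^-1 *: om i).[0] != 0 by rewrite om0 oner_neq0.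
    have y1 : 1 ^+ l (u i) = ((C i)^-1 *: om i).[0] by rewrite om0 expr1n.
    have [r r0 rn] := polyX_dvd_exp_root charK0 n (l_gt0 (u i)) om1 y1.
    by exists (u i, r); split; rewrite /= ?bu ?r0 ?oner_neq0.
  move: (Zi); rewrite -lt0n => /card_gt0P [v]; rewrite inE => /andP [/eqP bv /eqP xv].
  have om0 : ((C i)^-1 *: om i).[0] != 0.
    by rewrite /om (negbTE Zi) !hornerE mulf_neq0 ?invr_eq0.
  have [y yl] := exists_exp_root ((C i)^-1 *: om i).[0] (l_gt0 v).
  have [r r0 rn] := polyX_dvd_exp_root charK0 n (l_gt0 v) om0 yl.
  exists (v, r); split; rewrite //= ?xv ?eqxx // r0.
  apply: contraNneq om0 => y0.
  by rewrite -yl y0 expr0n eqn0Ngt l_gt0.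
pose c v := (g0 v)%:P * (if v == (pr (b v)).1 then (pr (b v)).2 else 1).
exists c; split.
- move=> v; rewrite /c hornerM hornerC mulf_neq0 //.
  by case: ifP => _; [have [] := hpr (b v) | rewrite hornerC oner_neq0].
- move=> v; rewrite hornerM hornerXn; have [xv|xv] := eqVneq (x v) 0.
    by rewrite expr0n eqn0Ngt a_gt0 ?mul0r.
  rewrite /a (negbTE xv) expr0 mul1r /c /g0 (negbTE xv) hornerM hornerC.
  case: eqP => [e|_]; last by rewrite hornerC mulr1.
  by have [_ _ ->] := hpr (b v); rewrite ?mulr1 // -e.
have blockW i : 'X^n %| along (fun v => 'X^(a v) * c v) (block i) - W i.
  have [bp _ _ hn] := hpr i.
  have -> : along (fun v => 'X^(a v) * c v) (block i) =
      'X^(if Z i == 0%N then 0 else D) * (C i *: (pr i).2 ^+ l (pr i).1).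
    rewrite along_block.
    rewrite (eq_bigr (fun v => 'X^(a v * l v) * c v ^+ l v)); last first.
      by move=> v _; rewrite exprMn exprM.
    rewrite big_split /= -asum; congr (_ * _).
      by rewrite prodrXr.
    rewrite /c (eq_bigr (fun v => (g0 v ^+ l v)%:P * (if v == (pr i).1 then (pr i).2 else 1) ^+ l v)); last first.
      by move=> v /eqP ->; rewrite exprMn -rmorphXn.
    rewrite big_split /= -rmorph_prod -mul_polyC; congr (_ * _).
    rewrite (bigD1 (pr i).1) ?bp //= eqxx big1 ?mulr1 // => v /andP [_ /negbTE ->].
    by rewrite expr1n.
  rewrite W_om -mulrBr dvdp_mull //.
  have -> : C i *: (pr i).2 ^+ l (pr i).1 - om i =
     C i *: ((pr i).2 ^+ l (pr i).1 - (C i)^-1 *: om i).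
    by rewrite scalerBr scalerA divff // scale1r.
  by rewrite -mul_polyC dvdp_mull.
move=> i i2.
(* W satisfies the linear equations exactly, so only the errors of the blocks against W remain. *)
have -> : along (fun v => 'X^(a v) * c v) (trinom i) =
  lam i *: (along (fun v => 'X^(a v) * c v) (block ord0) - W ord0)
  + (along (fun v => 'X^(a v) * c v) (block (inord 1)) - W (inord 1))
  + (along (fun v => 'X^(a v) * c v) (block i) - W i).
  have W0 : lam i *: W ord0 + W (inord 1) + W i = 0.
    have := Xx i i2; have := wL i i2.
    rewrite /trinom /binom !mevalD mevalZ /W.
    move: (block ord0).@[x] (block (inord 1)).@[x] (block i).@[x] => B0 B1 B2.
    move: (w ord0) (w (inord 1)) (w i) => w0' w1 w2 e1 e2.
    rewrite -!mul_polyC.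
    have -> : (lam i)%:P * (B0%:P + w0'%:P * 'X^D) + (B1%:P + w1%:P * 'X^D) + (B2%:P + w2%:P * 'X^D)
       = (lam i * B0 + B1 + B2)%:P + (lam i * w0' + w1 + w2)%:P * 'X^D.
      by rewrite !rmorphD !rmorphM /=; ring.
    by rewrite e1 e2 mul0r addr0.
  rewrite /trinom /binom /along !mmapD mmapZ -!/(along _ _) -mul_polyC.
  rewrite -[LHS]subr0 -W0 -!mul_polyC.
  by ring.
by do 2?[apply: dvdp_add => //]; rewrite -mul_polyC dvdp_mull.
Qed.

(** Along an approximating curve den^s has order exactly A s, while den^s f vanishes to order A s +
    1; hence f vanishes at the starting point [x]. *)
Lemma vanishing_extends f s x : in_ideal (den ^+ s * f) -> on_variety x -> f.@[x] = 0.
Proof.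
move=> [G eG] Xx; have [a ha] := approx_curve Xx.
pose e := (\sum_(i < k.+1 | (2 <= i)%N) coblock_exp i)%MM.
pose A := (\sum_v a v * e v)%N.
have [c [c0 cx cX]] := ha (A * s).+1.
pose ga := fun v => 'X^(a v) * c v.
have : 'X^((A * s).+1) %| along ga (den ^+ s * f).
  rewrite eG /along raddf_sum /=; elim/big_ind: _ => [|p q hp hq|i i2].
  - exact: dvdp0.
  - by rewrite dvdp_add.
  by rewrite rmorphM /= dvdp_mull // cX.
rewrite /along rmorphM rmorphXn /= -!/(along _ _) den_monomial along_monomial -/e -/A.
rewrite exprMn -exprM -mulrA exprSr dvdp_mul2l ?expf_neq0 ?polyX_eq0 //.
rewrite -['X]subr0 dvdp_XsubCl /root hornerM mulf_eq0 => /orP [].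
  rewrite horner_exp horner_prod expf_eq0 => /andP [_ /prodf_eq0 [v _]].
  by rewrite horner_exp expf_eq0 (negbTE (c0 v)) andbF.
rewrite horner_along => /eqP <-; apply: meval_eq => v; by rewrite cx.
Qed.

Lemma generic_vanishing f h x : h != 0 -> pivot_free h ->
  (forall y, on_variety y -> (forall v, y v != 0) -> h.@[y] != 0 -> f.@[y] = 0) ->
  on_variety x -> f.@[x] = 0.
Proof.
by move=> h0 fh /(generic_vanishing_in_ideal h0 fh) [s]; apply: vanishing_extends.
Qed.

(** * The dimension *)

Definition row_variety (x : 'rV[K]_N) := on_variety (x ord0).

Definition nonpivot v := ~~ pivot v.

Definition pull_free (P : {mpoly K[#|nonpivot|]}) : {mpoly K[N]} :=
  mmap (@mpolyC N K) (fun c => 'X_(enum_val c)) P.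

Lemma meval_pull_free P x : (pull_free P).@[x] = P.@[fun c => x (enum_val c)].
Proof.
rewrite [RHS]mevalE /pull_free /mmap rmorph_sum /=; apply: eq_bigr => m _.
rewrite mevalM mevalC rmorph_prod; congr (_ * _).
by apply: eq_bigr => c _; rewrite rmorphXn /= mevalXU.
Qed.

Lemma pull_free_pivot_free P : pivot_free (pull_free P).
Proof.
apply: exp_le_sum => m _; rewrite mul_mpolyC; apply: exp_leZ.
apply: pivot_free_prod => c _.
have fc : pivot_free 'X_(enum_val c).
  move=> m' w; rewrite msuppX inE => /eqP -> pw; rewrite mnm1E.
  by case: eqP => // e; have := enum_valP c; rewrite e unfold_in /nonpivot pw.
by have := exp_le_exp (n := m c) fc; apply: exp_leW => v _; rewrite muln0.
Qed.

Lemma pull_free_neq0 P : P != 0 -> pull_free P != 0.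
Proof.
move=> /(mpoly_neq0_point charK0) [y Py].
pose z v := if [pick c | enum_val c == v :> 'I_N] is Some c then y c else 0.
apply: contraNneq Py => e; apply/eqP; transitivity (pull_free P).@[z]; last first.
  by rewrite e meval0.
rewrite meval_pull_free; apply: meval_eq => c; rewrite /z.
by case: pickP => [c' /eqP /enum_val_inj ->|/(_ c)]; rewrite ?eqxx.
Qed.

Lemma pivot_free_reduced f : pivot_free f -> reduced f.
Proof. by apply: exp_leW. Qed.

Lemma free_alg_independent :
  alg_independent_on row_variety (fun c : 'I_#|nonpivot| => 'X_(enum_val c)).
Proof.
move=> P hP; apply/eqP; apply: contraT => /pull_free_neq0 P0.
have [x [Xx _]] := generic_point P0 (pivot_free_reduced (@pull_free_pivot_free P)).
rewrite meval_pull_free; case/eqP; pose r : 'rV[K]_N := \row_v x v.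
have rx : r ord0 =1 x by move=> v; rewrite mxE.
transitivity (P.@[fun c => evalp 'X_(enum_val c) r]).
  by apply: meval_eq => c; rewrite /evalp mevalXU rx.
apply: hP => i i2; rewrite -(Xx i i2); exact: meval_eq.
Qed.

(** Normal forms of products of powers of the g_i have exponents linear in n in the free coordinates
    and bounded in the pivots, so [mpoly_dep] yields a relation as soon as e exceeds the number of
    free coordinates. *)
Lemma alg_independent_le e (g : 'I_e -> {mpoly K[N]}) :
  alg_independent_on row_variety g -> (e <= #|nonpivot|)%N.
Proof.
move=> ind; rewrite leqNgt; apply/negP => de.
pose E := (\sum_i msize (g i))%N.
pose F n (h : {ffun 'I_e -> 'I_n}) := \prod_i g i ^+ h i.
have Fs n h m v : m \in msupp (@F n h) -> (m v <= n * E)%N.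
  by move=> mF; apply: power_product_exp_le mF isT.
pose L := (\max_v l v)%N; have lL v : (l v <= L)%N by apply: leq_bigmax.
(* Taking s = n E in [reduce_exp_le] bounds the exponents by n E (1 + (k + 1) L) < C n. *)
pose C := (E * (1 + k.+1 * L)).+1.
have [||||n [c [c0 hc]]] := @mpoly_dep K N [set v | nonpivot v] e L.+1 C (fun n h => reduce (n * E) (F n h)).
- by rewrite cardsE.
- by [].
- by [].
- move=> n h m v mR; rewrite inE /nonpivot; case: ifP => pv.
    have n0 : (0 < n)%N by case: n h {mR} => // h; case: (h (Ordinal (leq_ltn_trans (leq0n _) de))).
    have := @reduce_exp_le (F n h) (n * E) (fun m' v' => @Fs n h m' v') m v mR isT.
    move=> /leq_ltn_trans; apply; apply: leq_ltn_trans (_ : C.-1 * n < C * n)%N; last first.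
      by rewrite ltn_pmul2r.
    rewrite /C /= -[(n * E + _)%N]/(n * E + k.+1 * (n * E * l v))%N.
    apply: (@leq_trans (n * E + k.+1 * (n * E * L))%N).
      by rewrite leq_add2l !leq_mul2l lL !orbT.
    by apply: eq_leq; rewrite /= mulnDr muln1 mulnDl; congr (_ + _)%N; lia.
  have := @reduce_reduced (F n h) (n * E) m v mR; move/negbFE: pv => pv /(_ pv).
  by have := lL v; have := l_gt0 v; lia.
have [P P0 Pe] := exponent_poly c0.
case/eqP: P0; apply: ind => x Xx; pose f := \sum_h c h *: F n h.
rewrite Pe; transitivity f.@[x ord0].
  rewrite /f rmorph_sum; apply: eq_bigr => h _; rewrite /= mevalZ rmorph_prod; congr (_ * _).
  by apply: eq_bigr => i _; rewrite rmorphXn.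
apply: (@vanishing_extends f (n * E)); last exact: Xx.
(* The subtracted combination of normal forms is zero by the choice of [c]. *)
have -> : den ^+ (n * E) * f = den ^+ (n * E) * f - \sum_h c h *: reduce (n * E) (F n h).
  by rewrite hc subr0.
rewrite mulr_sumr; apply: eq_mod_sum => h _; rewrite -scalerAr -!mul_mpolyC.
apply: eq_modM; first exact: eq_mod_refl.
by apply: reduce_eq_mod => m v; apply: Fs.
Qed.

Lemma row_variety_dim : has_dim row_variety #|nonpivot|.
Proof.
split; first by exists (fun c : 'I_#|nonpivot| => 'X_(enum_val c)); exact: free_alg_independent.
exact: alg_independent_le.
Qed.

(** * Tangent spaces and a regular point *)

Definition dirderiv (x v : 'I_N -> K) f := \sum_j f^`M(j).@[x] * v j.

Lemma dirderivM x (v : 'I_N -> K) f g :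
  dirderiv x v (f * g) = f.@[x] * dirderiv x v g + dirderiv x v f * g.@[x].
Proof.
rewrite /dirderiv mulr_sumr mulr_suml -big_split /=; apply: eq_bigr => j _.
rewrite mderivM mevalD !mevalM; ring.
Qed.

Lemma dirderiv_sum x (v : 'I_N -> K) (I : Type) (s : seq I) (Q : pred I) (f : I -> {mpoly K[N]}) :
  dirderiv x v (\sum_(i <- s | Q i) f i) = \sum_(i <- s | Q i) dirderiv x v (f i).
Proof.
rewrite /dirderiv exchange_big /=; apply: eq_bigr => j _.
by rewrite (raddf_sum (mderiv j)) (raddf_sum (meval x)) mulr_suml.
Qed.

Lemma den_neq0 x : (forall v, x v != 0) -> den.@[x] != 0.
Proof.
move=> x0; rewrite den_monomial mevalX; apply/prodf_neq0 => v _.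
by rewrite expf_neq0.
Qed.

(** If f vanishes on X, then den^s f is a combination of the trinomials; by the Leibniz rule at [x],
    where f and the trinomials vanish but den does not, df is a combination of their
    differentials. *)
Lemma tangentP (x v : 'rV[K]_N) : row_variety x -> (forall w, x ord0 w != 0) ->
  tangent row_variety x v <->
  forall i, (2 <= i)%N -> dirderiv (x ord0) (v ord0) (trinom i) = 0.
Proof.
move=> Xx x0; split=> [tv i i2|tv f fX]; first by apply: tv => y Xy; apply: Xy.
have [s [G eG]] : exists s, in_ideal (den ^+ s * f).
  apply: (@generic_vanishing_in_ideal f 1); rewrite ?oner_neq0 //; first exact: exp_le1.
  move=> y Xy _ _; pose r : 'rV[K]_N := \row_v y v.
  have ry : r ord0 =1 y by move=> j; rewrite mxE.
  rewrite -(meval_eq _ ry); apply: fX => i i2; rewrite -(Xy i i2); exact: meval_eq.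
have fx : f.@[x ord0] = 0 by apply: fX.
have : dirderiv (x ord0) (v ord0) (den ^+ s * f) = 0.
  rewrite eG dirderiv_sum big1 // => i i2.
  by rewrite dirderivM tv // Xx // !mulr0 addr0.
rewrite dirderivM fx mulr0 addr0 => /eqP; rewrite mulf_eq0 rmorphXn expf_eq0.
by rewrite (negbTE (den_neq0 x0)) andbF => /eqP.
Qed.

Lemma mderiv_block_pivot x i (j : 'I_k.+1) : (2 <= j)%N -> (forall v, x v != 0) ->
  ((block i)^`M(u j).@[x] == 0) = (i != j).
Proof.
move=> j2 x0; rewrite mderivX mevalZ mevalX mnmE bu mulf_eq0.
have -> : (\prod_v x v ^+ (block_exp i - U_(u j))%MM v == 0) = false.
  by apply/negbTE/prodf_neq0 => v _; rewrite expf_neq0.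
rewrite orbF [i == j]eq_sym; have [e|] := eqVneq j i; last by rewrite eqxx.
by move/pcharf0P: charK0 => ->; rewrite eqn0Ngt l_gt0.
Qed.

Lemma mderiv_trinom_pivot x i (j : 'I_k.+1) : (2 <= i)%N -> (2 <= j)%N -> (forall v, x v != 0) ->
  ((trinom i)^`M(u j).@[x] == 0) = (i != j).
Proof.
move=> i2 j2 x0; rewrite /trinom /binom !mderivD mderivZ !mevalD mevalZ.
have /eqP -> : (block ord0)^`M(u j).@[x] == 0.
  by rewrite mderiv_block_pivot //; apply/eqP => e; rewrite -e in j2.
have /eqP -> : (block (inord 1))^`M(u j).@[x] == 0.
  by rewrite mderiv_block_pivot //; apply/eqP => e; rewrite -e val_inord1 in j2.
by rewrite mulr0 !add0r mderiv_block_pivot.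
Qed.

Definition jacobian x : 'M[K]_(N, #|pivot|) :=
  \matrix_(j, c) (trinom (b (enum_val c)))^`M(j).@[x].

Lemma mul_jacobian x (v : 'rV[K]_N) c :
  (v *m jacobian x) ord0 c = dirderiv x (v ord0) (trinom (b (enum_val c))).
Proof. by rewrite mxE; apply: eq_bigr => j _; rewrite mxE mulrC. Qed.

(** At a generic point the pivot rows of the Jacobian form an invertible diagonal matrix, so the
    tangent space has as many dimensions as there are free coordinates. *)
Lemma regular_point_tangent : exists (x : 'rV[K]_N) (v : 'rV[K]_N),
  [/\ regular_point row_variety x, tangent row_variety x v & v != 0].
Proof.
have [x0 [Xx0 x00 _]] : exists x, [/\ on_variety x, forall v, x v != 0 & (1 : {mpoly K[N]}).@[x] != 0].
  by apply: generic_point; [exact: oner_neq0 | exact: exp_le1].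
pose x : 'rV[K]_N := \row_v x0 v.
have xx : x ord0 =1 x0 by move=> j; rewrite mxE.
have Xx : row_variety x by move=> i i2; rewrite -(Xx0 i i2); exact: meval_eq.
have xn v : x ord0 v != 0 by rewrite xx.
pose phi := linfun (mulmxr (jacobian (x ord0)) : 'rV[K]_N -> 'rV[K]_#|pivot|).
have Ut (v : 'rV[K]_N) : v \in lker phi <-> tangent row_variety x v.
  rewrite tangentP // memv_ker lfunE /=; split=> [/eqP h i i2|h].
    have pu : u i \in pivot by rewrite -[_ \in _]/(pivot _) pivot_u.
    have := mul_jacobian (x ord0) v (enum_rank_in pu (u i)).
    by rewrite h mxE enum_rankK_in // bu => <-.
  apply/eqP/rowP => c; rewrite mul_jacobian mxE; apply: h.
  by have := enum_valP c; rewrite unfold_in => /andP [].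
(* A preimage supported on the pivots is found by dividing by the diagonal entries. *)
have full : limg phi = fullv.
  apply/vspaceP => w; rewrite memvf; apply/memv_imgP.
  pose v : 'rV[K]_N := \row_j if [pick c | enum_val c == j :> 'I_N] is Some c
     then w ord0 c / (trinom (b j))^`M(j).@[x ord0] else 0.
  exists v; rewrite ?memvf // lfunE /=; apply/rowP => c; rewrite mul_jacobian /dirderiv.
  have pc := enum_valP c; rewrite unfold_in in pc; have /andP [c2 /eqP ec] := pc.
  rewrite (bigD1 (enum_val c)) //= big1 => [|j jc].
    rewrite addr0 mxE; case: pickP => [c' /eqP /enum_val_inj ->|/(_ c)]; last by rewrite eqxx.
    rewrite mulrC divfK // ec bu mderiv_trinom_pivot ?eqxx //.
  rewrite mxE; case: pickP => [c' /eqP ej|]; last by rewrite mulr0.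
  have := enum_valP c'; rewrite ej unfold_in => /andP [j2 /eqP uj].
  rewrite uj; have /eqP -> : (trinom (b (enum_val c)))^`M(u (b j)).@[x ord0] == 0; last by rewrite mul0r.
  rewrite mderiv_trinom_pivot //; apply: contraNneq jc => e.
  by rewrite uj -e -ec.
have dimU : \dim (lker phi) = #|nonpivot|.
  have := limg_ker_dim phi fullv; rewrite capfv full !dimvf /dim /= !mul1n => e.
  have := cardC pivot; rewrite card_ord -[RHS]e addnC => /addIn <-.
  by apply: eq_card.
have U0 : lker phi != 0%VS.
  rewrite -dimv_eq0 dimU -lt0n; apply/card_gt0P; exists (u ord0).
  by rewrite -[_ \in _]/(~~ pivot _) pivot_u.
exists x, (vpick (lker phi)); split; last by rewrite vpick0.
- by split=> //; exists (lker phi); split=> //; rewrite dimU; exact: row_variety_dim.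
- by apply/Ut; exact: memv_pick.
Qed.

(** Trivial actions have zero velocity, so they cannot span a nonzero tangent space. *)
Lemma rigid_not_flexible : rigid row_variety -> ~ flexible row_variety.
Proof.
move=> rig fl; have [x [v [rx tv v0]]] := regular_point_tangent.
have [+ _] := fl x rx v; move=> /(_ tv) [s hs vs].
suff s0 : (<<s>> <= 0)%VS.
  by move: v0; rewrite -memv0 (subvP s0).
apply/span_subvP => w /hs [F gF ->]; rewrite memv0; apply/eqP/rowP => i.
rewrite !mxE; have Xx : row_variety x by case: rx.
have -> : orbit_poly F x i = (x ord0 i)%:P.
  apply/eqP; rewrite -subr_eq0; apply/eqP; apply: (poly_eq0_everywhere charK0) => t.
  have /rowP/(_ i) := rig F gF t x Xx; rewrite mxE hornerD hornerN hornerC => ->.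
  by rewrite subrr.
by rewrite derivC horner0.
Qed.

(** * Orbits that avoid the common zeros of the blocks *)

Section Rigidity.
Variables i1 i2 : 'I_k.+1.
Hypothesis i1_ge2 : (2 <= i1)%N.
Hypothesis i2_ge2 : (2 <= i2)%N.
Hypothesis i12 : i1 != i2.
Hypothesis l_even : forall v, (b v < 2)%N -> ~~ odd (l v).
Hypothesis l_ge2_1 : forall v, b v = i1 -> (2 <= l v)%N.
Hypothesis l_ge2_2 : forall v, b v = i2 -> (2 <= l v)%N.
Hypothesis lam_neq0 : forall i, (2 <= i)%N -> lam i != 0.
Hypothesis lam_inj : forall i (j : 'I_k.+1), (2 <= i)%N -> (2 <= j)%N -> i != j -> lam i != lam j.

Section Orbit.
Variable c : 'I_N -> {poly K}.
Hypothesis c_neq0 : forall v, c v != 0.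
Hypothesis c_on : forall i, (2 <= i)%N -> along c (trinom i) = 0.

(** The square roots y_0, y_1 of B_0, B_1 along the curve. *)
Definition half_block i : {poly K} := \prod_(v | b v == i) c v ^+ (l v)./2.

Lemma half_block_sq i : (i < 2)%N -> half_block i ^+ 2 = along c (block i).
Proof.
move=> ilt; rewrite along_block /half_block -prodrXl; apply: eq_bigr => v /eqP bv.
rewrite -exprM muln2; congr (_ ^+ _).
by rewrite -[RHS]odd_double_half (negbTE (l_even _)) // bv.
Qed.

Lemma along_block_neq0 i : along c (block i) != 0.
Proof. by rewrite along_block; apply/prodf_neq0 => v _; rewrite expf_neq0. Qed.

Lemma along_blockE i mu : (2 <= i)%N -> mu ^+ 2 = - lam i ->
  (half_block (inord 1) + mu *: half_block ord0) *
  (half_block (inord 1) + (- mu) *: half_block ord0) = - along c (block i).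
Proof.
move=> i2' emu; have := c_on i2'; rewrite /trinom /binom /along !mmapD mmapZ -!/(along _ _)
  -(half_block_sq (i := ord0)) // -(half_block_sq (i := inord 1)) ?val_inord1 //.
move: (half_block ord0) (half_block (inord 1)) (along c (block i)) => y0 y1 B h.
rewrite -[RHS]addr0 -h.
have -> : lam i = - mu ^+ 2 by rewrite emu opprK.
by rewrite -!mul_polyC !rmorphN rmorphXn /=; ring.
Qed.

Lemma squareful_block i : (forall v, b v = i -> (2 <= l v)%N) -> squareful (- along c (block i)).
Proof.
move=> li r; rewrite dvdpNr rootN along_block => h.
have {h} [v bv cv] : exists2 v, b v == i & root (c v) r.
  move: h; rewrite /root horner_prod => /prodf_eq0 [v bv].
  by rewrite horner_exp expf_eq0 => /andP [_ ?]; exists v.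
rewrite (bigD1 v) //= dvdp_mulr //.
apply: dvdp_trans (dvdp_exp2l _ (li v (eqP bv))).
by rewrite dvdp_exp2r // dvdp_XsubCl.
Qed.

Lemma orbit_constant :
  ~ (exists r, root (half_block ord0) r /\ root (half_block (inord 1)) r) ->
  forall v, (size (c v) <= 1)%N.
Proof.
move=> ncr; set y0 := half_block ord0 in ncr *; set y1 := half_block (inord 1) in ncr *.
have two0 : 2%:R != 0 :> K by move/pcharf0P: charK0 => ->.
have [m1 em1] := @exists_exp_root K 2 (- lam i1) isT.
have [m2 em2] := @exists_exp_root K 2 (- lam i2) isT.
have m1n0 : m1 != 0.
  by apply: contraNneq (lam_neq0 i1_ge2) => e; rewrite -[lam i1]opprK -em1 e expr0n oppr0.
have m2n0 : m2 != 0.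
  by apply: contraNneq (lam_neq0 i2_ge2) => e; rewrite -[lam i2]opprK -em2 e expr0n oppr0.
have sq12 : m1 ^+ 2 != m2 ^+ 2 by rewrite em1 em2 eqr_opp lam_inj.
have opp_neq (m : K) : m != 0 -> m != - m.
  by move=> m0; rewrite -subr_eq0 opprK -mulr2n -mulr_natr mulf_neq0.
(* Four distinct members of the pencil, since lam_i1 and lam_i2 are nonzero and distinct and 2 is
   invertible. *)
pose s := [:: m1; - m1; m2; - m2]; pose cc (j : 'I_4) := nth 0 s j.
have us : uniq s.
  have h (x y : K) : x ^+ 2 = m1 ^+ 2 -> y ^+ 2 = m2 ^+ 2 -> x != y.
    by move=> ex ey; apply: contraNneq sq12 => e; rewrite -ex e ey.
  by rewrite /s /= !inE !negb_or !opp_neq // !h ?sqrrN.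
have cI : injective cc.
  move=> i j; rewrite /cc => /eqP; rewrite nth_uniq ?ltn_ord // => /eqP; exact: val_inj.
(* A common root of y_1 + mu y_0 and y_1 - mu y_0 would be one of y_0 and y_1; so each factor
   inherits multiple roots from the product - B_i. *)
have sqf_mu i (mu : K) : (2 <= i)%N -> (forall v, b v = i -> (2 <= l v)%N) ->
    mu != 0 -> mu ^+ 2 = - lam i ->
    y1 + mu *: y0 != 0 /\ squareful (y1 + mu *: y0).
  move=> ige2 li mu0 emu; have e := along_blockE ige2 emu; split.
    apply: contraTneq (along_block_neq0 i) => e0.
    by move: e; rewrite -/y0 -/y1 e0 mul0r => /esym/eqP; rewrite oppr_eq0 negbK.
  apply: (@squareful_factor K _ (y1 + (- mu) *: y0)); last first.
    by rewrite -/y0 -/y1 in e; rewrite e; apply: squareful_block.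
  move=> r rp; apply/negP => rq; apply: ncr; exists r; move: rp rq.
  rewrite /root !hornerE => /eqP rp /eqP rq.
  have e0 : y0.[r] = 0.
    apply/eqP; have : 2%:R * mu * y0.[r] = 0.
      by transitivity ((y1.[r] + mu * y0.[r]) - (y1.[r] + - mu * y0.[r])); [ring|rewrite rp rq subrr].
    by move/eqP; rewrite !mulf_eq0 (negbTE two0) (negbTE mu0).
  by split; [rewrite e0 | move: rp; rewrite e0 mulr0 addr0 => ->].
have all4 j : y1 + cc j *: y0 != 0 /\ squareful (y1 + cc j *: y0).
  have := mem_nth 0 (ltn_ord j : (j < size s)%N); rewrite -/(cc j) !inE.
  by case/or4P => /eqP ->; [apply: (@sqf_mu i1) | apply: (@sqf_mu i1) |
    apply: (@sqf_mu i2) | apply: (@sqf_mu i2)]; rewrite ?oppr_eq0 ?sqrrN.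
have [s0 s1] := @four_squareful_pencil K charK0 y0 y1 cc cI (coprimep_no_common_root ncr)
   (fun j => (all4 j).1) (fun j => (all4 j).2).
have y00 i : half_block i != 0 by apply/prodf_neq0 => v _; rewrite expf_neq0.
have dvd_const (p q : {poly K}) : p %| q -> q != 0 -> (size q <= 1)%N -> (size p <= 1)%N.
  by move=> pq q0; apply: leq_trans; apply: dvdp_leq.
(* Every coordinate divides a nonzero constant: y_0 or y_1 in the first two blocks, - B_i in the
   others. *)
have low v : (b v < 2)%N -> c v %| half_block (b v).
  move=> bv; rewrite /half_block (bigD1 v) //= dvdp_mulr //.
  rewrite -[c v in X in X %| _]expr1 dvdp_exp2l // half_gt0.
  by have := l_even bv; have := l_gt0 v; case: (l v) => [|[|]].
move=> v; case: (ltnP (b v) 2) => bv.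
  apply: dvd_const (low v bv) (y00 _) _.
  case: (b v) bv {low} => [[|[|//]]] p _ /=.
    by have -> : Ordinal p = ord0 by apply: val_inj.
  by have -> : Ordinal p = inord 1 by apply: val_inj; rewrite /= val_inord1.
have [mu emu] := @exists_exp_root K 2 (- lam (b v)) isT.
apply: (dvd_const _ (- along c (block (b v)))).
- rewrite dvdpNr along_block (bigD1 v) //= dvdp_mulr //.
  by rewrite -[c v in X in X %| _]expr1 dvdp_exp2l.
- by rewrite oppr_eq0 along_block_neq0.
rewrite -(along_blockE bv emu) -/y0 -/y1.
by rewrite (size1_polyC s0) (size1_polyC s1) -!mul_polyC -!rmorphM -!rmorphD -rmorphM size_polyC leq_b1.
Qed.

End Orbit.

(** * Orbits that meet the common zeros of the blocks *)

Section Action.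
Variable F : 'I_N -> {poly {mpoly K[N]}}.
Hypothesis F_action : Ga_action row_variety F.

Lemma orbit_on (x : 'rV[K]_N) i : row_variety x -> (2 <= i)%N ->
  along (orbit_poly F x) (trinom i) = 0.
Proof.
move=> Xx i2'; apply: (poly_eq0_everywhere charK0) => t; rewrite horner_along.
have [+ _ _] := F_action; move=> /(_ t x Xx) /(_ i i2') <-.
by apply: meval_eq => v; rewrite mxE.
Qed.

Lemma orbit_start (x : 'rV[K]_N) v : row_variety x -> (orbit_poly F x v).[0] = x ord0 v.
Proof. by move=> Xx; have [_ + _] := F_action => /(_ x Xx) /rowP /(_ v); rewrite mxE. Qed.

Lemma orbit_trivial_or_meets (x : 'rV[K]_N) : row_variety x -> (forall v, x ord0 v != 0) ->
  ~ (exists r, forall i, (block i).@[flow F r x ord0] = 0) ->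
  forall t, flow F t x = x.
Proof.
move=> Xx x0 nm t; pose c := orbit_poly F x.
have c0 v : c v != 0.
  by apply: contraNneq (x0 v) => e; rewrite -orbit_start // -/c e horner0.
have c_on i : (2 <= i)%N -> along c (trinom i) = 0 by exact: orbit_on.
have const : forall v, (size (c v) <= 1)%N.
  apply: orbit_constant => // -[r [r0 r1]]; apply: nm; exists r.
  have bE i : (block i).@[flow F r x ord0] = (along c (block i)).[r].
    by rewrite horner_along; apply: meval_eq => v; rewrite mxE.
  have b0 : (along c (block ord0)).[r] = 0.
    by rewrite -half_block_sq // horner_exp (eqP r0) expr0n.
  have b1 : (along c (block (inord 1))).[r] = 0.
    by rewrite -half_block_sq ?val_inord1 // horner_exp (eqP r1) expr0n.
  move=> i; rewrite bE; case: (ltnP i 2) => ige2.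
    case: i ige2 => [[|[|//]]] p _ /=.
      by have -> : Ordinal p = ord0 by apply: val_inj.
    by have -> : Ordinal p = inord 1 by apply: val_inj; rewrite /= val_inord1.
  move: (congr1 (fun p : {poly K} => p.[r]) (c_on i ige2)).
  rewrite /trinom /binom /along !mmapD mmapZ -!/(along _ _) !hornerE b0 b1.
  by rewrite mulr0 !add0r.
apply/rowP => v; rewrite mxE -/c -[RHS](orbit_start v Xx) -/c.
by rewrite (size1_polyC (const v)) !hornerC.
Qed.

(* Coordinate v of (t, z) |-> t.z on the subspace where all z_(sg i) vanish; the
   unused variable X_(sg 0) stands for t. *)
Definition sweep_coord (sg : 'I_k.+1 -> 'I_N) v : {mpoly K[N]} :=
  (map_poly (mmap (@mpolyC N K) (fun w => if w == sg (b w) then 0 else 'X_w)) (F v)).['X_(sg ord0)].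

Lemma meval_sweep_coord sg (z : 'rV[K]_N) t v : (forall i, b (sg i) = i) ->
  (forall i, z ord0 (sg i) = 0) ->
  (sweep_coord sg v).@[fun w => if w == sg ord0 then t else z ord0 w] = (orbit_poly F z v).[t].
Proof.
move=> bsg zsg; set p := (X in _.@[X]).
rewrite /sweep_coord -horner_map -map_poly_comp /= mevalXU /orbit_poly.
have -> : p (sg ord0) = t by rewrite /p eqxx.
congr (_.[t]); apply: eq_map_poly => f /=.
rewrite [RHS]mevalE /mmap rmorph_sum; apply: eq_bigr => m _.
rewrite /= mevalM mevalC; congr (_ * _); rewrite /mmap1 rmorph_prod; apply: eq_bigr => w _.
rewrite /= rmorphXn; congr (_ ^+ _); case: eqP => [e|e]; first by rewrite e zsg; exact: meval0.
rewrite /= mevalXU /p; case: eqP => // e'; by rewrite e' bsg in e.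
Qed.

Definition sweep_vars (sg : 'I_k.+1 -> 'I_N) : {set 'I_N} :=
  [set w | (w != sg (b w)) || (w == sg ord0)].

Lemma sweep_coord_vars sg v :
  exp_le (fun w => w \notin sweep_vars sg) (fun=> 0%N) (sweep_coord sg v).
Proof.
set P := (fun w => _).
have leX w : w \in sweep_vars sg -> exp_le P (fun=> 0%N) ('X_w : {mpoly K[N]}).
  move=> wJ m w'; rewrite msuppX inE => /eqP -> pw; rewrite mnm1E.
  by case: eqP => // e; rewrite /P -e wJ in pw.
have leXn (f : {mpoly K[N]}) n : exp_le P (fun=> 0%N) f -> exp_le P (fun=> 0%N) (f ^+ n).
  by move=> /(exp_le_exp (n := n)); apply: exp_leW => w _; rewrite muln0.
rewrite /sweep_coord horner_coef; apply: exp_le_sum => i _.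
apply: (@exp_leMW _ _ _ _ (fun=> 0%N) (fun=> 0%N)) => //; last first.
  by apply: leXn; apply: leX; rewrite inE eqxx orbT.
rewrite coef_map; apply: exp_le_sum => m _; rewrite mul_mpolyC; apply: exp_leZ.
have : exp_le P (fun _ => \sum_(w < N) 0)%N
   (\prod_(w < N) (if w == sg (b w) then 0 else 'X_w : {mpoly K[N]}) ^+ m w).
  apply: exp_le_prod => w _; apply: leXn; case: ifPn => wsg.
    by move=> m' w'; rewrite -mpolyC0 msupp0.
  by apply: leX; rewrite inE wsg.
by apply: exp_leW => w _; rewrite big1.
Qed.

(** Dropping k + 1 coordinates and adding the time leaves N - k variables, one fewer than the N - (k
    - 1) free coordinates. *)
Lemma card_sweep_vars sg : (forall i, b (sg i) = i) -> (#|sweep_vars sg| < #|nonpivot|)%N.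
Proof.
move=> bsg.
have h : (#|pivot| < #|~: sweep_vars sg|)%N.
  pose A := [set sg (b v) | v in pivot].
  have <- : #|A| = #|pivot|.
    apply: card_in_imset => v w /andP [_ /eqP ev] /andP [_ /eqP ew] /(congr1 b).
    by rewrite !bsg => e; rewrite ev ew e.
  apply: proper_card; rewrite properE; apply/andP; split.
    apply/subsetP => _ /imsetP [v /andP [bv _] ->]; rewrite !inE bsg eqxx /=.
    by apply: contraTneq bv => /(congr1 b); rewrite !bsg => ->.
  apply/subsetPn; exists (sg (inord 1)).
    rewrite !inE bsg eqxx /=; apply/eqP => /(congr1 b); rewrite !bsg => /(congr1 val).
    by rewrite /= val_inord1.
  apply/imsetP => -[v /andP [bv _]] /(congr1 b); rewrite !bsg => e.
  by rewrite -e val_inord1 in bv.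
have e1 := cardC pivot; have e2 := cardsC (sweep_vars sg).
have <- : #|[predC pivot]| = #|nonpivot| by apply: eq_card.
move: h e1 e2; rewrite !card_ord.
move: #|pivot| #|[predC pivot]| #|sweep_vars sg| #|~: sweep_vars sg|; lia.
Qed.

(** Each choice [sg] of one vanishing coordinate per block gives a relation among the free
    coordinates of the swept points; the product over all [sg] excludes every orbit meeting the
    locus. *)
Lemma generic_orbit_trivial : exists h, [/\ h != 0, pivot_free h &
  forall (x : 'rV[K]_N), row_variety x -> (forall v, x ord0 v != 0) -> h.@[x ord0] != 0 ->
    forall t, flow F t x = x].
Proof.
have /fin_all_exists [P hP] : forall sg : {ffun 'I_k.+1 -> 'I_N}, exists P : {mpoly K[#|nonpivot|]},
    P != 0 /\ ((forall i, b (sg i) = i) ->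
       forall y, P.@[fun c => (sweep_coord sg (enum_val c)).@[y]] = 0).
  move=> sg; have [/forallP bsg|nb] := boolP [forall i, b (sg i) == i].
    have bsg' i : b (sg i) = i by apply/eqP.
    have [P P0 Pe] := few_variables_alg_dep (card_sweep_vars bsg')
      (fun c => @sweep_coord_vars sg (enum_val c)).
    by exists P.
  (* Maps [sg] that are not sections of [b] contribute a factor 1. *)
  exists 1; split; first exact: oner_neq0.
  by move=> bsg; case/negP: nb; apply/forallP => i; rewrite bsg.
exists (pull_free (\prod_sg P sg)); split.
- by apply: pull_free_neq0; apply/prodf_neq0 => sg _; have [] := hP sg.
- exact: pull_free_pivot_free.
move=> x Xx x0 hx; apply: orbit_trivial_or_meets => // -[r hr].
have /fin_all_exists [sg hsg] : forall i, exists v, b v = i /\ flow F r x ord0 v = 0.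
  move=> i; have /eqP := hr i; rewrite meval_block => /prodf_eq0 [v /eqP bv].
  by rewrite expf_eq0 => /andP [_ /eqP xv]; exists v.
have bsg i : b (finfun sg i) = i by rewrite ffunE; have [] := hsg i.
move: hx; rewrite meval_pull_free rmorph_prod => /prodf_neq0 /(_ (finfun sg) isT) /=.
have [_ /(_ bsg)] := hP (finfun sg).
pose z := flow F r x; have zsg i : z ord0 (finfun sg i) = 0 by rewrite ffunE; have [] := hsg i.
(* The point x is recovered from z by flowing for time - r, which is placed in the slot of a
   coordinate vanishing at z. *)
move=> /(_ (fun w => if w == finfun sg ord0 then - r else z ord0 w)) <-.
case/eqP; apply: meval_eq => c; rewrite meval_sweep_coord //.
have [_ Fx Fadd] := F_action.
have := Fadd (- r) r x Xx; rewrite addNr Fx // => /rowP /(_ (enum_val c)).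
by rewrite mxE.
Qed.

Lemma action_trivial : trivial_action row_variety F.
Proof.
move=> t x Xx; apply/rowP => v; rewrite mxE.
have [h [h0 fh hx]] := generic_orbit_trivial.
(* The displacement of one coordinate at a fixed time is a polynomial, so its generic vanishing
   extends to all of X. *)
pose f := (F v).[t%:MP] - 'X_v.
have fE y : f.@[y] = (map_poly (meval y) (F v)).[t] - y v.
  by rewrite /f mevalB mevalXU -horner_map /= mevalC.
suff : f.@[x ord0] = 0 by rewrite fE => /eqP; rewrite subr_eq0 => /eqP.
apply: (generic_vanishing h0 fh) => // y Xy y0 hy.
pose r : 'rV[K]_N := \row_w y w.
have ry : r ord0 =1 y by move=> w; rewrite mxE.
have Xr : row_variety r by move=> i ige2; rewrite -(Xy i ige2); exact: meval_eq.
have /rowP /(_ v) : flow F t r = r.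
  by apply: hx => // [w|]; rewrite ?ry // (meval_eq _ ry).
rewrite !mxE => e; rewrite -(meval_eq _ ry) fE ry.
by rewrite -/(orbit_poly F r v) e subrr.
Qed.

End Action.

Lemma row_variety_rigid : rigid row_variety.
Proof. by move=> F; apply: action_trivial. Qed.

End Rigidity.

End TrinomialCore.

(** * Passage to the doubly indexed coordinates *)

Section Coordinates.
Variables (K : closedFieldType) (charK0 : [pchar K] =i pred0).
Variables (k : nat) (n : 'I_k.+1 -> nat) (n_ge1 : forall i, (1 <= n i)%N).
Variables (lam : 'I_k.+1 -> K) (l : forall i : 'I_k.+1, 'I_(n i) -> nat).

Definition coord_block (v : 'I_#|var_index n|) : 'I_k.+1 := tag (enum_val v).
Definition coord_exp (v : 'I_#|var_index n|) : nat := l (tagged (enum_val v)).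
Definition first_coord (i : 'I_k.+1) : 'I_#|var_index n| :=
  enum_rank (Tagged (fun i => 'I_(n i)) (Ordinal (n_ge1 i)) : var_index n).

Lemma first_coordK i : coord_block (first_coord i) = i.
Proof. by rewrite /coord_block enum_rankK. Qed.

Lemma Tmonomial_block i : Tmonomial K l i = block K coord_block coord_exp i.
Proof.
rewrite /block mpolyXE_id.
pose f (x : var_index n) : {mpoly K[#|var_index n|]} :=
  if tag x == i then 'X_(enum_rank x) ^+ l (tagged x) else 1.
transitivity (\prod_(x : var_index n) f x); last first.
  rewrite (reindex (fun v : 'I_#|var_index n| => enum_val v : var_index n)) /=; last first.
    by exists enum_rank => x _; rewrite ?enum_rankK ?enum_valK.
  apply: eq_bigr => v _; rewrite mnmE /f enum_valK -/(coord_block v).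
  by case: ifP; rewrite ?expr0.
pose g (i' : 'I_k.+1) (j : 'I_(n i')) := f (Tagged (fun i => 'I_(n i)) j).
transitivity (\prod_i' \prod_(j < n i') @g i' j); last first.
  rewrite (sig_big_dep (fun=> true) (fun i' _ => true) g) /=.
  by apply: eq_bigr => -[].
rewrite (bigD1 i) //= [X in _ * X]big1 => [|i' /negbTE i'i].
  by rewrite mulr1; apply: eq_bigr => j _; rewrite /g /f eqxx.
by apply: big1 => j _; rewrite /g /f /= i'i.
Qed.

Lemma trinomial_row_variety :
  trinomial_variety lam l = row_variety coord_block coord_exp lam.
Proof.
have e : trinomial lam l = trinom coord_block coord_exp lam.
  by apply: functional_extensionality => i; rewrite /trinomial !Tmonomial_block.
by rewrite /trinomial_variety e.
Qed.

Lemma trinomial_variety_rigid (i1 i2 : 'I_k.+1) :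
  (forall i (j : 'I_(n i)), (0 < l j)%N) ->
  (forall (i : 'I_k.+1) (j : 'I_(n i)), (i < 2)%N -> ~~ odd (l j)) ->
  (2 <= i1)%N -> (2 <= i2)%N -> i1 != i2 ->
  (forall j : 'I_(n i1), (2 <= l j)%N) -> (forall j : 'I_(n i2), (2 <= l j)%N) ->
  (forall i : 'I_k.+1, (2 <= i)%N -> lam i != 0) ->
  (forall i j : 'I_k.+1, (2 <= i)%N -> (2 <= j)%N -> i != j -> lam i != lam j) ->
  rigid (trinomial_variety lam l) /\ ~ flexible (trinomial_variety lam l).
Proof.
move=> l0 lev i1ge i2ge i12 l1 l2 lam0 lamI.
have k2 : (2 <= k)%N by apply: leq_trans i1ge _; rewrite -ltnS.
rewrite trinomial_row_variety.
have le i : (forall j : 'I_(n i), (2 <= l j)%N) ->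
    forall v, coord_block v = i -> (2 <= coord_exp v)%N.
  by move=> li v; rewrite /coord_block /coord_exp; case: (enum_val v) => i' j /= e; subst i'.
have rig : rigid (row_variety coord_block coord_exp lam).
  apply: (row_variety_rigid charK0 k2 _ first_coordK i1ge i2ge i12) => //.
  - by move=> v; apply: l0.
  - by move=> v; apply: lev.
  - exact: le.
  - exact: le.
split=> //; apply: (rigid_not_flexible charK0 k2 _ first_coordK) => //.
by move=> v; apply: l0.
Qed.

End Coordinates.

Theorem mainTheorem2 (K : closedFieldType) (charK0 : [pchar K] =i pred0)
    (k : nat) (k_ge3 : (3 <= k)%N)
    (n : 'I_k.+1 -> nat) (n_ge1 : forall i, (1 <= n i)%N)
    (lam : 'I_k.+1 -> K)
    (lam_neq0 : forall i : 'I_k.+1, (2 <= i)%N -> lam i != 0)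
    (lam_inj : forall i j : 'I_k.+1, (2 <= i)%N -> (2 <= j)%N ->
       i != j -> lam i != lam j) :
  (forall m : forall i : 'I_k.+1, 'I_(n i) -> nat,
     (forall (i : 'I_k.+1) (j : 'I_(n i)), (1 <= j)%N -> (0 < m i j)%N) ->
     rigid (V5 lam m) /\ ~ flexible (V5 lam m))
  /\
  (forall l : forall i : 'I_k.+1, 'I_(n i) -> nat,
     (forall (i : 'I_k.+1) (j : 'I_(n i)), (2 <= i)%N -> (0 < l i j)%N) ->
     (exists i1 i2 : 'I_k.+1,
        [/\ (2 <= i1)%N, (2 <= i2)%N, i1 != i2,
            ~ (exists j : 'I_(n i1), l i1 j = 1%N)
          & ~ (exists j : 'I_(n i2), l i2 j = 1%N)]) ->
     rigid (V2 lam l) /\ ~ flexible (V2 lam l)).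
Proof.
split=> [m m0|l l0 [i1 [i2 [i1ge i2ge i12 l1 l2]]]].
  have v2 : (inord 2 : 'I_k.+1) = 2%N :> nat by rewrite inordK // ltnS ltnW.
  have v3 : (inord 3 : 'I_k.+1) = 3%N :> nat by rewrite inordK.
  (* All exponents of type V_5 are at least 2, so any two blocks beyond the first two will do; k >=
     3 provides the indices 2 and 3. *)
  have ge2 i (j : 'I_(n i)) : (2 <= exponents_V5 m j)%N.
    rewrite /exponents_V5; case: eqP => // /eqP; rewrite -lt0n => /m0.
    by case: (m i j) => // p _; rewrite mulnS.
  apply: (@trinomial_variety_rigid _ charK0 _ _ n_ge1 _ _ (inord 2) (inord 3)) => //.
  - by move=> i j; apply: leq_trans (ge2 i j).
  - by move=> i j _; rewrite /exponents_V5; case: ifP => // _; rewrite mul2n odd_double.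
  - by rewrite v2.
  - by rewrite v3.
  - by apply/eqP => /(congr1 val) /=; rewrite v2 v3.
have ge2 (i : 'I_k.+1) : (2 <= i)%N -> ~ (exists j : 'I_(n i), l i j = 1%N) ->
    forall j : 'I_(n i), (2 <= exponents_V2 l j)%N.
  move=> ige li j; rewrite /exponents_V2 [(i < 2)%N]ltnNge ige /=.
  have := l0 i j ige; case e : (l i j) => [|[|p]] // _.
  by case: li; exists j.
apply: (@trinomial_variety_rigid _ charK0 _ _ n_ge1 _ _ i1 i2) => //.
- by move=> i j; rewrite /exponents_V2; case: (ltnP i 2) => //; apply: l0.
- by move=> i j i2'; rewrite /exponents_V2 i2'.
- exact: ge2.
- exact: ge2.
Qed.
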